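(* Let $N$ be a bilinear Fourier multiplier with symbol $n$ and $P$ a trilinear Fourier multiplier with symbol $p$, and let $\mathcal{P}(u)=\int_{\mathbb{R}}P(u,u,u)\,dx$. Assume that for some $t>0$ $$|p(\xi-\eta,\eta-\sigma,\sigma)|\lesssim\langle\xi-\eta\rangle^t\langle\eta-\sigma\rangle^t\langle\sigma\rangle^t,\qquad |n(\xi-\eta,\eta)|\lesssim\langle\xi\rangle^t\langle\xi-\eta\rangle^t\langle\eta\rangle^t.$$ Let $s>t+\frac12$. Then the Fréchet derivative of $\mathcal{P}$ on $H^s(\mathbb{R})$ satisfies $$D\mathcal{P}[u](v)=\int_{\mathbb{R}}vN(u,u)\,dx\qquad\text{for }u,v\in H^s(\mathbb{R})$$ if and only if $$n(\xi-\eta,\eta)=p(\eta,\xi-\eta,-\xi)+p(-\xi,\eta,\xi-\eta)+p(\xi-\eta,-\xi,\eta).$$ In this case, $$\mathcal{P}(u)=\int_{\mathbb{R}}P(u,u,u)\,dx=\frac13\int_{\mathbb{R}}uN(u,u)\,dx.$$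
   Context: $\langle\xi\rangle=(1+\xi^2)^{1/2}$; $\hat f(\xi)=(2\pi)^{-1/2}\int_{\mathbb{R}} f(x)e^{-i\xi x}\,dx$; $H^s(\mathbb{R})$ is the $L^2$-based Sobolev space; $\lesssim$ hides a multiplicative constant. The multipliers are normalized so that the constant symbol $1$ gives the pointwise product: $$\widehat{N(u,v)}(\xi)=(2\pi)^{-1/2}\int_{\mathbb{R}}n(\xi-\eta,\eta)\hat u(\xi-\eta)\hat v(\eta)\,d\eta,$$ $$\widehat{P(u,v,w)}(\xi)=(2\pi)^{-1}\int_{\mathbb{R}^2}p(\xi-\eta,\eta-\sigma,\sigma)\hat u(\xi-\eta)\hat v(\eta-\sigma)\hat w(\sigma)\,d\sigma\,d\eta.$$ Integrals such as $\int P(u,u,u)\,dx$ and $\int vN(u,u)\,dx$ are understood through their frequency-side expressions, $\int_{\mathbb{R}} f\,dx=(2\pi)^{1/2}\hat f(0)$ and $\int_{\mathbb{R}} vN(u,u)\,dx=\int_{\mathbb{R}}\hat v(-\xi)\widehat{N(u,u)}(\xi)\,d\xi$.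
   Formalization: The claim that the derivative formula forces the symbol identity fails for non-symmetric symbols (p=0, n(a,b)=a−b); the equivalence is proved for the symmetrized n and p, hence literally for symmetric n and p, with the identity holding almost everywhere. *)

(* Defs.v *)
From HB Require Import structures.
From mathcomp Require Import all_boot all_order all_algebra.
From mathcomp Require Import all_classical all_reals all_analysis.
From mathcomp Require Export complex.
Set Implicit Arguments.
Unset Strict Implicit.
Unset Printing Implicit Defensive.
Import Order.TTheory GRing.Theory Num.Theory.
Import numFieldNormedType.Exports.
Local Open Scope classical_set_scope.
Local Open Scope ring_scope.
Local Open Scope complex_scope.

Section ComplexValued.
Context {R : realType}.
Local Notation leb := (@lebesgue_measure R).

(* The modulus, as an element of R rather than of R[i]. *)
Definition cmod (z : R[i]) : R := complex.Re `|z|.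

Definition cis (x : R) : R[i] := cos x +i* sin x.

Definition cmeasurable d (T : measurableType d) (f : T -> R[i]) : Prop :=
  measurable_fun setT (fun x => complex.Re (f x)) /\
  measurable_fun setT (fun x => complex.Im (f x)).

Definition cintegral d (T : measurableType d)
    (mu : {measure set T -> \bar R}) (f : T -> R[i]) : R[i] :=
  Rintegral mu setT (fun x => complex.Re (f x)) +i*
  Rintegral mu setT (fun x => complex.Im (f x)).

Definition normL2 (f : R -> R[i]) : \bar R :=
  ('N[leb]_2%:E[EFin \o (cmod \o f)])%E.

Definition in_L2 (f : R -> R[i]) : Prop :=
  cmeasurable (f : measurableTypeR R -> R[i]) /\ (normL2 f < +oo)%E.

End ComplexValued.

Section Sobolev.
Context {R : realType}.
Local Notation leb := (@lebesgue_measure R).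
Implicit Types (u v w g : R -> R[i]) (s : R).

Definition fourierL1 u (xi : R) : R[i] :=
  ((Num.sqrt (2 * pi))^-1)%:C *
  cintegral leb (fun x : R => u x * cis (- (xi * x))).

Definition truncate (k : nat) u (x : R) : R[i] :=
  if `|x| <= k%:R then u x else 0.

(* The Fourier transform on L^2, which is given by the integral only in the
   limit: g is the L^2-limit of the transforms of the truncations of u. *)
Definition is_fourier u g : Prop :=
  [/\ in_L2 u, in_L2 g &
    (fun k : nat => normL2 (fun xi => g xi - fourierL1 (truncate k u) xi))
      @ \oo --> 0%E].

(* A representative of the L^2 Fourier transform of u (determined only almost
   everywhere), and 0 if there is none. *)
Definition fourier u : R -> R[i] := xget (fun=> 0) [set g | is_fourier u g].

Definition japanese (xi : R) : R := Num.sqrt (1 + xi ^+ 2).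

Definition sobolev_weight s g (xi : R) : R[i] := (japanese xi `^ s)%:C * g xi.

(* The elements of H^s(R), s >= 0, as functions rather than classes of
   functions modulo equality almost everywhere. *)
Definition sobolev s u : Prop :=
  is_fourier u (fourier u) /\ in_L2 (sobolev_weight s (fourier u)).

Definition sobolev_norm s u : R := fine (normL2 (sobolev_weight s (fourier u))).

(* L is the Frechet derivative at u of Phi : H^s(R) -> C.  Boundedness of L
   makes it well defined on classes modulo equality almost everywhere. *)
Definition is_frechet_derivative s (Phi : (R -> R[i]) -> R[i]) u
    (L : (R -> R[i]) -> R[i]) : Prop :=
  [/\ forall (a : R[i]) v w, sobolev s v -> sobolev s w ->
        L (fun x => a * v x + w x) = a * L v + L w,
      exists C : R, forall v, sobolev s v -> cmod (L v) <= C * sobolev_norm s v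
    & forall e : R, 0 < e -> exists2 d : R, 0 < d &
        forall h, sobolev s h -> sobolev_norm s h < d ->
          cmod (Phi (fun x => u x + h x) - Phi u - L h)
            <= e * sobolev_norm s h].

End Sobolev.

Section Multipliers.
Context {R : realType}.
Local Notation leb := (@lebesgue_measure R).
Local Notation leb2 := (leb \x leb)%E.
Implicit Types (n : R -> R -> R[i]) (p : R -> R -> R -> R[i]).
Implicit Types (u v w : R -> R[i]).

(* The Fourier transforms of N(u, v) and P(u, v, w). *)
Definition bilinear_hat n u v (xi : R) : R[i] :=
  ((Num.sqrt (2 * pi))^-1)%:C *
  cintegral leb
    (fun eta : R => n (xi - eta) eta * fourier u (xi - eta) * fourier v eta).

Definition trilinear_hat p u v w (xi : R) : R[i] :=
  ((2 * pi)^-1)%:C *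
  cintegral leb2
    (fun z : R * R => let: (eta, sigma) := z in
       p (xi - eta) (eta - sigma) sigma *
       fourier u (xi - eta) * fourier v (eta - sigma) * fourier w sigma).

(* The integrals of P(u, u, u) and of v N(u, u) over R. *)
Definition integral_P p u : R[i] :=
  (Num.sqrt (2 * pi))%:C * trilinear_hat p u u u 0.

Definition integral_vN n v u : R[i] :=
  cintegral leb (fun xi : R => fourier v (- xi) * bilinear_hat n u u xi).

Definition derivative_formula (s : R) n p : Prop :=
  forall u, sobolev s u ->
    is_frechet_derivative s (integral_P p) u (fun v => integral_vN n v u).

Definition symbol_identity n p : Prop :=
  {ae leb2, forall z : R * R, let: (xi, eta) := z in
     n (xi - eta) eta =
       p eta (xi - eta) (- xi) + p (- xi) eta (xi - eta)
       + p (xi - eta) (- xi) eta}.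

(* N(u, u) and P(u, u, u) depend only on the symmetrizations of their
   symbols. *)
Definition symmetrize2 n (a b : R) : R[i] := (n a b + n b a) / 2%:R.

Definition symmetrize3 p (a b c : R) : R[i] :=
  (p a b c + p a c b + p b a c + p b c a + p c a b + p c b a) / 6%:R.

Definition symmetric2 n : Prop := forall a b, n a b = n b a.

Definition symmetric3 p : Prop :=
  forall a b c, p a b c = p b a c /\ p a b c = p a c b.

End Multipliers.

(* Main.v *)
Require Import Defs.
From mathcomp Require Import all_boot all_order all_algebra.
From mathcomp Require Import all_classical all_reals all_analysis.
From mathcomp Require Import measurable_realfun.
From mathcomp Require Import ring lra.
Import Order.TTheory GRing.Theory Num.Theory.
Import numFieldNormedType.Exports.
Local Open Scope classical_set_scope.
Local Open Scope ring_scope.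
Local Open Scope complex_scope.

(** On the plane of pairs [(xi, eta)] put the three frequencies
    [x1 = - xi], [x2 = xi - eta], [x3 = eta], whose sum is zero. Up to one and
    the same constant, the functional and the pairing are values of the form
    [T_m (f, g, h)], the integral over the plane of
    [m * f x1 * g x2 * h x3] ([trilinear]): the cubic functional is
    [T_m (u^, u^, u^)] for the symbol [p (x1, x2, x3)], and the pairing with the
    quadratic term is [T_m (v^, u^, u^)] for the symbol [n (x2, x3)]
    ([integral_P_trilinear], [integral_vN_trilinear]). Both symbols are bounded
    by a multiple of [<x1>^t <x2>^t <x3>^t], so that Cauchy-Schwarz in one
    variable and the integrability of [<x>^t |h x|] for [h] in the weighted
    space with [s > t + 1/2] bound the form on [H^s] ([trilinear_bound]).

    Existence of the derivative. A bounded trilinear form on the diagonal has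
    at [u] the derivative [T (v, u, u) + T (u, v, u) + T (u, u, v)]. The
    exchanges of [x1] with [x2] and of [x2] with [x3] are linear involutions of
    the plane that preserve Lebesgue measure; they move [v] to the first slot
    and turn the derivative into [T_q (v, u, u)] with
    [q = p (x1, x2, x3) + p (x2, x1, x3) + p (x2, x3, x1)]
    ([cubic_frechet_derivative]).

    The criterion. The derivative is unique, hence the formula says that
    [T_D (v^, u^, u^) = 0] for all [u] and [v], where [D] is [n (x2, x3) - q].
    By polarization this is [T_M = 0] on all triples of transforms, where [M]
    is [D] plus its image under the exchange of [x2] and [x3]
    ([diagonal_vanishes_iff]). The map that sends [M] to [T_M] is injective
    modulo null sets ([symbol_vanishes]): for every bounded interval there is
    an element of [H^s] whose transform is a nonzero multiple of the indicator
    of that interval, therefore [M] has integral zero on every rectangle and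
    vanishes almost everywhere. Finally [M] is
    [n (x2, x3) + n (x3, x2)] minus the sum of [p] over the six orders of
    [(x1, x2, x3)], which is twice the defect of the symbol identity for the
    symmetrized symbols. The identity for [n] and [p] themselves, added to its
    image under the exchange of [x2] and [x3], gives [M = 0] too.

    The last assertion is Euler's identity: at [v = u] the derivative of a cubic
    form is three times its value.

    The test functions are [cis (mu * x) * sin (r * x) / x]. Their truncated
    transforms are sums of two values of the sine integral, which converge in
    [L^2] because the sine integral tends to its limit [c] at the rate [1 / y]
    ([Si_error]). Only [c > 0] matters, to make the multiple of the indicator
    nonzero, and the value of [c] is not computed. *)

Set Implicit Arguments.
Unset Strict Implicit.

(** * Modulus, measurability and integration of complex functions *)

Section Modulus.
Context {R : realType}.
Implicit Types (z w : R[i]).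

Lemma cmodE z : cmod z = Num.sqrt (complex.Re z ^+ 2 + complex.Im z ^+ 2).
Proof. by case: z. Qed.

Lemma cmod_ge0 z : 0 <= cmod z.
Proof. by rewrite cmodE sqrtr_ge0. Qed.

Lemma cmodM z w : cmod (z * w) = cmod z * cmod w.
Proof. exact: ComplexField.Normc.normcM. Qed.

Lemma cmodD z w : cmod (z + w) <= cmod z + cmod w.
Proof. exact: le_normcD. Qed.

Lemma cmodN z : cmod (- z) = cmod z.
Proof. exact: normcN. Qed.

Lemma cmod_real (x : R) : cmod x%:C = `|x|.
Proof. by rewrite cmodE /= expr0n addr0 sqrtr_sqr. Qed.

Lemma cmod0 : cmod (0 : R[i]) = 0.
Proof. by rewrite (cmod_real 0) normr0. Qed.

Lemma cmod_eq0 z : (cmod z == 0) = (z == 0).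
Proof.
apply/eqP/eqP => [|->]; last exact: cmod0.
exact: ComplexField.Normc.eq0_normc.
Qed.

Lemma normr_Re_le z : `|complex.Re z| <= cmod z.
Proof. by rewrite cmodE -sqrtr_sqr ler_wsqrtr// lerDl sqr_ge0. Qed.

Lemma normr_Im_le z : `|complex.Im z| <= cmod z.
Proof. by rewrite cmodE -sqrtr_sqr ler_wsqrtr// lerDr sqr_ge0. Qed.

Lemma cmod_le_ReIm z : cmod z <= `|complex.Re z| + `|complex.Im z|.
Proof.
rewrite cmodE -[leRHS]ger0_norm ?addr_ge0// -sqrtr_sqr ler_wsqrtr//.
rewrite -[X in X + _ <= _]real_normK ?num_real//.
rewrite -[X in _ + X <= _]real_normK ?num_real//.
by rewrite sqrrD lerD2r lerDl mulrn_wge0 ?mulr_ge0.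
Qed.

Lemma ReD z w : complex.Re (z + w) = complex.Re z + complex.Re w.
Proof. by case: z w => [? ?] [? ?]. Qed.

Lemma ImD z w : complex.Im (z + w) = complex.Im z + complex.Im w.
Proof. by case: z w => [? ?] [? ?]. Qed.

Lemma ReN z : complex.Re (- z) = - complex.Re z.
Proof. by case: z. Qed.

Lemma ImN z : complex.Im (- z) = - complex.Im z.
Proof. by case: z. Qed.

Lemma ReM z w :
  complex.Re (z * w) = complex.Re z * complex.Re w - complex.Im z * complex.Im w.
Proof. by case: z w => [? ?] [? ?]. Qed.

Lemma ImM z w :
  complex.Im (z * w) = complex.Re z * complex.Im w + complex.Im z * complex.Re w.
Proof. by case: z w => [? ?] [? ?]. Qed.

Lemma complex_ext z w :
  complex.Re z = complex.Re w -> complex.Im z = complex.Im w -> z = w.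
Proof. by case: z w => [? ?] [? ?] /= -> ->. Qed.

Lemma cmod_cis (x : R) : cmod (cis x) = 1.
Proof. by rewrite cmodE /= cos2Dsin2 sqrtr1. Qed.

End Modulus.

Section ComplexMeasurable.
Context d (T : measurableType d) {R : realType}.
Implicit Types (f g : T -> R[i]).

Lemma cmeasurable_cst (z : R[i]) : cmeasurable (fun _ : T => z).
Proof. by split; exact: measurable_cst. Qed.

Lemma cmeasurable_real (f : T -> R) :
  measurable_fun setT f -> cmeasurable (fun x => (f x)%:C).
Proof. by move=> mf; split => //; exact: measurable_cst. Qed.

Lemma cmeasurableD f g : cmeasurable f -> cmeasurable g ->
  cmeasurable (fun x => f x + g x).
Proof.
move=> [f1 f2] [g1 g2]; split.
  under eq_fun do rewrite ReD; exact: measurable_funD.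
under eq_fun do rewrite ImD; exact: measurable_funD.
Qed.

Lemma cmeasurableM f g : cmeasurable f -> cmeasurable g ->
  cmeasurable (fun x => f x * g x).
Proof.
move=> [f1 f2] [g1 g2]; split.
  under eq_fun do rewrite ReM.
  by apply: measurable_funB; apply: measurable_funM.
under eq_fun do rewrite ImM.
by apply: measurable_funD; apply: measurable_funM.
Qed.

Lemma cmeasurableN f : cmeasurable f -> cmeasurable (fun x => - f x).
Proof.
move=> [f1 f2]; split.
  under eq_fun do rewrite ReN; exact: measurableT_comp.
under eq_fun do rewrite ImN; exact: measurableT_comp.
Qed.

Lemma cmeasurableB f g : cmeasurable f -> cmeasurable g ->
  cmeasurable (fun x => f x - g x).
Proof. by move=> mf mg; apply: cmeasurableD => //; exact: cmeasurableN. Qed.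

Lemma measurable_cmod f : cmeasurable f ->
  measurable_fun setT (fun x => cmod (f x)).
Proof.
move=> [f1 f2]; under eq_fun do rewrite cmodE.
apply: (measurableT_comp (continuous_measurable_fun (@sqrt_continuous R))).
by apply: measurable_funD; exact: measurable_funX.
Qed.

End ComplexMeasurable.

Lemma cmeasurable_comp {R : realType} d1 d2 (T1 : measurableType d1)
    (T2 : measurableType d2) (f : T2 -> R[i]) (g : T1 -> T2) :
  cmeasurable f -> measurable_fun setT g -> cmeasurable (fun x => f (g x)).
Proof.
move=> [f1 f2] mg; split.
  exact: (measurableT_comp f1 mg).
exact: (measurableT_comp f2 mg).
Qed.

Lemma cmeasurable_cis {R : realType} :
  cmeasurable (cis : measurableTypeR R -> R[i]).
Proof.
split; apply: continuous_measurable_fun => x;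
  [exact: continuous_cos|exact: continuous_sin].
Qed.

Section AlmostEverywhere.
Context d (T : measurableType d) {R : realType}.
Variable mu : {measure set T -> \bar R}.

Lemma ae_imply (P Q : T -> Prop) : (forall x, P x -> Q x) ->
  {ae mu, forall x, P x} -> {ae mu, forall x, Q x}.
Proof. by move=> PQ; apply: filterS. Qed.

Lemma ae_imply2 (P Q S : T -> Prop) : (forall x, P x -> Q x -> S x) ->
  {ae mu, forall x, P x} -> {ae mu, forall x, Q x} -> {ae mu, forall x, S x}.
Proof. by move=> PQS; apply: filterS2. Qed.

End AlmostEverywhere.

Section ComplexIntegral.
Context d (T : measurableType d) {R : realType}.
Variable mu : {measure set T -> \bar R}.
Implicit Types (f g : T -> R[i]).

Definition cintegrable f : Prop :=
  mu.-integrable setT (fun x => (complex.Re (f x))%:E) /\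
  mu.-integrable setT (fun x => (complex.Im (f x))%:E).

Lemma cintegrable_le f (g : T -> R) : cmeasurable f ->
  mu.-integrable setT (EFin \o g) -> (forall x, cmod (f x) <= g x) ->
  cintegrable f.
Proof.
move=> [f1 f2] ig fg; split.
  apply: (le_integrable _ _ _ ig) => //; first exact/measurable_EFinP.
  move=> x _ /=; rewrite lee_fin (le_trans (normr_Re_le _))//.
  by rewrite (le_trans (fg x))// ler_norm.
apply: (le_integrable _ _ _ ig) => //; first exact/measurable_EFinP.
move=> x _ /=; rewrite lee_fin (le_trans (normr_Im_le _))//.
by rewrite (le_trans (fg x))// ler_norm.
Qed.

Lemma cintegrable_lty f : cmeasurable f ->
  (\int[mu]_x (cmod (f x))%:E < +oo)%E -> cintegrable f.
Proof.
move=> mf foo; apply: (@cintegrable_le _ (fun x => cmod (f x))) => //.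
apply/integrableP; split; first exact/measurable_EFinP/measurable_cmod.
by under eq_integral do rewrite /= ger0_norm ?cmod_ge0//.
Qed.

Lemma cmeasurable_integrable f : cintegrable f -> cmeasurable f.
Proof.
by move=> [/measurable_int/measurable_EFinP f1 /measurable_int/measurable_EFinP].
Qed.

Lemma integrableZl_EFin (c : R) (h : T -> R) :
  mu.-integrable setT (EFin \o h) ->
  mu.-integrable setT (EFin \o (fun x => c * h x)).
Proof. exact: (integrableZl measurableT). Qed.

Lemma cintegrableZl (a : R[i]) f : cintegrable f ->
  cintegrable (fun x => a * f x).
Proof.
move=> [f1 f2]; split.
  under eq_fun do rewrite ReM EFinB !EFinM.
  by apply: integrableB => //; exact: (integrableZl measurableT).
under eq_fun do rewrite ImM EFinD !EFinM.
by apply: integrableD => //; exact: (integrableZl measurableT).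
Qed.

Lemma eq_cintegral f g : f =1 g -> cintegral mu f = cintegral mu g.
Proof. by move=> /funext ->. Qed.

Lemma cintegral0 : cintegral mu (fun=> 0) = 0.
Proof. by rewrite /cintegral /= Rintegral_cst// mul0r. Qed.

Lemma cintegralD f g : cintegrable f -> cintegrable g ->
  cintegral mu (fun x => f x + g x) = cintegral mu f + cintegral mu g.
Proof.
move=> [f1 f2] [g1 g2]; apply: complex_ext; rewrite ?(ReD, ImD) /= -RintegralD//.
  by apply: eq_Rintegral => x _; rewrite ReD.
by apply: eq_Rintegral => x _; rewrite ImD.
Qed.

Lemma cintegralZl (a : R[i]) f : cintegrable f ->
  cintegral mu (fun x => a * f x) = a * cintegral mu f.
Proof.
move=> [f1 f2]; apply: complex_ext; rewrite ?(ReM, ImM) /=.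
  rewrite -!RintegralZl// -RintegralB//; [|exact: integrableZl_EFin..].
  by apply: eq_Rintegral => x _; rewrite ReM.
rewrite -!RintegralZl// -RintegralD//; [|exact: integrableZl_EFin..].
by apply: eq_Rintegral => x _; rewrite ImM.
Qed.

Lemma cintegral_ae f g : cmeasurable f -> cmeasurable g ->
  {ae mu, forall x, f x = g x} -> cintegral mu f = cintegral mu g.
Proof.
move=> [f1 f2] [g1 g2] fg; apply: complex_ext; rewrite /= /Rintegral; congr fine;
  (apply: ae_eq_integral => //; [exact/measurable_EFinP..|]);
  by apply: filterS fg => x /= -> _.
Qed.

(** Real and imaginary parts are estimated separately, whence the factor 2;
    any constant would serve for the boundedness of a form. *)
Lemma cmod_cintegral_le f (B : R) : cintegrable f ->
  (\int[mu]_x (cmod (f x))%:E <= B%:E)%E -> cmod (cintegral mu f) <= 2 * B.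
Proof.
move=> fi fB; have [f1 f2] := fi.
have mf := measurable_cmod (cmeasurable_integrable fi).
have half (g : T -> R) : mu.-integrable setT (EFin \o g) ->
    (forall x, `|g x| <= cmod (f x)) -> `|\int[mu]_x g x| <= B.
  move=> ig gf; rewrite -lee_fin EFin_normr_Rintegral//.
  have mg := measurable_int _ ig.
  apply: (le_trans (le_abse_integral mu measurableT mg)).
  apply: le_trans fB; apply: ge0_le_integral => //.
  - exact: measurableT_comp.
  - exact/measurable_EFinP.
  - by move=> x _; rewrite lee_fin.
apply: (le_trans (cmod_le_ReIm _)); rewrite mulr2n mulrDl mul1r lerD//.
  by apply: half => // x; exact: normr_Re_le.
by apply: half => // x; exact: normr_Im_le.
Qed.

End ComplexIntegral.

(** * The space of square integrable functions *)

Section L2.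
Context {R : realType}.
Local Notation leb := (@lebesgue_measure R).
Local Notation cmeasR f := (@cmeasurable R _ (measurableTypeR R) f).
Implicit Types (f g : R -> R[i]).

Definition energy f : \bar R := (\int[leb]_x (cmod (f x) ^+ 2)%:E)%E.

Lemma energy_ge0 f : (0 <= energy f)%E.
Proof. by apply: integral_ge0 => x _; rewrite lee_fin sqr_ge0. Qed.

Lemma normL2_energy f : (normL2 f = energy f `^ 2^-1)%E.
Proof.
rewrite /normL2 unlock; congr (_ `^ _)%E; apply: eq_integral => x _ /=.
by rewrite ger0_norm ?cmod_ge0// -powR_mulrn ?cmod_ge0.
Qed.

Lemma normL2_ge0 f : (0 <= normL2 f)%E.
Proof. by rewrite normL2_energy poweR_ge0. Qed.

Lemma energyE f : (energy f = normL2 f * normL2 f)%E.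
Proof.
rewrite normL2_energy; move: (energy f) (energy_ge0 f) => [x||]//.
  rewrite lee_fin => x0; rewrite poweR_EFin -EFinM.
  by rewrite powR12_sqrt// -expr2 sqr_sqrtr.
by rewrite poweRyr ?invr_neq0// mulyy.
Qed.

Lemma normL2_le f (c : R) : 0 <= c -> (energy f <= (c ^+ 2)%:E)%E ->
  (normL2 f <= c%:E)%E.
Proof.
move=> c0 fc; rewrite leNgt; apply/negP => cf.
have : (c%:E * c%:E < normL2 f * normL2 f)%E.
  move: (normL2_ge0 f) cf; case: (normL2 f) => [x||] //.
    rewrite -!EFinM !lte_fin lee_fin => x0 cx.
    by rewrite -!expr2 ltr_pXn2r ?nnegrE.
  by move=> _ _; rewrite mulyy -EFinM ltry.
by rewrite -energyE -EFinM -expr2 ltNge fc.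
Qed.

Lemma normL2_lty f : (normL2 f < +oo)%E <-> (energy f < +oo)%E.
Proof.
rewrite energyE; case: (normL2 f) (normL2_ge0 f) => [x||]// _.
by rewrite -EFinM !ltry.
Qed.

Lemma le_normL2 f g : cmeasR f ->
  cmeasR g ->
  (forall x, cmod (f x) <= cmod (g x)) -> (normL2 f <= normL2 g)%E.
Proof.
move=> mf mg fg; rewrite !normL2_energy.
apply: gt0_ler_poweR; rewrite ?invr_ge0//;
  do ?by rewrite in_itv/= energy_ge0 leey.
apply: ge0_le_integral => //.
- by move=> x _; rewrite lee_fin sqr_ge0.
- exact/measurable_EFinP/measurable_funX/measurable_cmod.
- exact/measurable_EFinP/measurable_funX/measurable_cmod.
- by move=> x _; rewrite lee_fin ler_pXn2r ?nnegrE ?cmod_ge0.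
Qed.

Lemma normL2D f g : cmeasR f ->
  cmeasR g ->
  (normL2 (fun x => f x + g x)%R <= normL2 f + normL2 g)%E.
Proof.
move=> mf mg; pose h x := (cmod (f x) + cmod (g x))%:C.
apply: (@le_trans _ _ (normL2 h)).
  apply: le_normL2.
  - exact: cmeasurableD.
  - apply: cmeasurable_real.
    by apply: measurable_funD; apply: measurable_cmod.
  - by move=> x; rewrite /h cmod_real ger0_norm ?addr_ge0 ?cmod_ge0// cmodD.
have -> : normL2 h = ('N[leb]_2%:E[EFin \o ((cmod \o f) \+ (cmod \o g))%R])%E.
  rewrite /normL2; congr Lnorm; apply/funext => x /=.
  by rewrite /h cmod_real ger0_norm ?addr_ge0 ?cmod_ge0.
by apply: minkowski_EFin; [exact: measurable_cmod|exact: measurable_cmod|rewrite ler1n].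
Qed.

Lemma normL2Z (a : R[i]) f : cmeasR f ->
  normL2 (fun x => a * f x) = ((cmod a)%:E * normL2 f)%E.
Proof.
move=> mf; rewrite !normL2_energy.
have -> : energy (fun x => a * f x) = ((cmod a ^+ 2)%:E * energy f)%E.
  rewrite /energy -ge0_integralZl//.
  - by apply: eq_integral => x _; rewrite cmodM exprMn EFinM.
  - exact/measurable_EFinP/measurable_funX/measurable_cmod.
  - by move=> x _; rewrite lee_fin sqr_ge0.
  - by rewrite lee_fin sqr_ge0.
rewrite poweRM ?energy_ge0 ?lee_fin ?sqr_ge0//; congr (_ * _)%E.
by rewrite poweR_EFin powR12_sqrt ?sqr_ge0// sqrtr_sqr ger0_norm ?cmod_ge0.
Qed.

Lemma normL2N f : normL2 (fun x => - f x) = normL2 f.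
Proof. by rewrite /normL2; congr Lnorm; apply/funext => x /=; rewrite cmodN. Qed.

Lemma normL2_ae f g : cmeasR f ->
  cmeasR g ->
  {ae leb, forall x, f x = g x} -> normL2 f = normL2 g.
Proof.
move=> mf mg fg; rewrite !normL2_energy; congr (_ `^ _)%E.
apply: ae_eq_integral => //.
- exact/measurable_EFinP/measurable_funX/measurable_cmod.
- exact/measurable_EFinP/measurable_funX/measurable_cmod.
- by apply: ae_imply fg => x /= ->.
Qed.

Lemma normL2_eq0 f : cmeasR f ->
  normL2 f = 0%E -> {ae leb, forall x, f x = 0}.
Proof.
move=> mf f0.
have : ae_eq leb setT (EFin \o (cmod \o f)) (cst 0%E).
  apply: (@Lnorm_eq0_eq0 _ _ _ _ _ 2%:E) => //.
  exact/measurable_EFinP/measurable_cmod.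
apply: ae_imply => x /(_ I) /= [] /eqP; by rewrite cmod_eq0 => /eqP.
Qed.

Lemma cauchy_schwarz f g : cmeasR f -> cmeasR g ->
  (\int[leb]_x (cmod (f x) * cmod (g x))%:E <= normL2 f * normL2 g)%E.
Proof.
move=> mf mg.
have h2 : 2^-1 + 2^-1 = 1 :> R by lra.
have := @hoelder _ _ _ leb (cmod \o f) (cmod \o g) 2 2
  (measurable_cmod mf) (measurable_cmod mg) ltac:(by []) ltac:(by []) h2.
rewrite Lnorm1; apply: le_trans.
rewrite le_eqVlt; apply/orP; left; apply/eqP; apply: eq_integral => x _ /=.
by rewrite ger0_norm// mulr_ge0 ?cmod_ge0.
Qed.

Lemma in_L2D f g : in_L2 f -> in_L2 g -> in_L2 (fun x => f x + g x).
Proof.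
move=> [mf f2] [mg g2]; split; first exact: cmeasurableD.
by apply: le_lt_trans (normL2D mf mg) _; rewrite lte_add_pinfty.
Qed.

Lemma in_L2Z (a : R[i]) f : in_L2 f -> in_L2 (fun x => a * f x).
Proof.
move=> [mf f2]; split.
  by apply: cmeasurableM => //; exact: cmeasurable_cst.
by rewrite normL2Z// lte_mul_pinfty ?lee_fin ?cmod_ge0.
Qed.

End L2.

(** * Powers of the bracket *)

Section Japanese.
Context {R : realType}.
Local Notation leb := (@lebesgue_measure R).
Implicit Types (x s t : R).

Lemma japanese_ge1 x : 1 <= japanese x.
Proof.
by rewrite /japanese -[leLHS]sqrtr1 ler_wsqrtr// lerDl sqr_ge0.
Qed.

Lemma japanese_gt0 x : 0 < japanese x.
Proof. exact: lt_le_trans (japanese_ge1 x). Qed.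

Lemma japaneseN x : japanese (- x) = japanese x.
Proof. by rewrite /japanese sqrrN. Qed.

Lemma continuous_japanese : continuous (@japanese R).
Proof.
move=> x; apply: (@continuous_comp _ _ _ (fun x : R => 1 + x ^+ 2) Num.sqrt).
  exact: continuous_oneDsqr.
exact: sqrt_continuous.
Qed.

Lemma measurable_japanese : measurable_fun setT (@japanese R).
Proof. by apply: continuous_measurable_fun; exact: continuous_japanese. Qed.

Lemma measurable_japanese_powR s :
  measurable_fun setT (fun x : R => japanese x `^ s).
Proof.
exact: (measurableT_comp (measurable_powR s) measurable_japanese).
Qed.

(** By the primitive [(1 + x) `^ (1 - a) / (1 - a)], which vanishes at
    infinity. *)
Lemma integrable_onex_powR (a : R) : 1 < a ->
  (\int[leb]_(x in `[0%R, +oo[) ((1 + x) `^ (- a))%:E < +oo)%E.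
Proof.
move=> a1; have a10 : 0 < a - 1 by rewrite subr_gt0.
pose F (x : R) := (1 + x) `^ (1 - a) / (1 - a).
have D (x : R) : 0 <= x -> is_derive x 1 F ((1 + x) `^ (- a)).
  move=> x0; rewrite /F.
  have x1 : 0 < 1 + x by rewrite ltr_pwDl.
  have D1 : is_derive (1 + x) 1 (fun y : R => y `^ (1 - a))
      ((1 - a) * (1 + x) `^ (- a)).
    by have := is_derive1_powR (1 - a) x1; rewrite addrAC subrr add0r.
  have D2 : is_derive x 1 (fun y : R => 1 + y) 1.
    rewrite -[X in is_derive _ _ _ X]add0r.
    exact: (@is_deriveD R R^o R^o (cst 1) id x 1 0 1 (is_derive_cst _ _ _)
      (is_derive_id _ _)).
  have D3 := @is_derive1_comp _ _ _ _ _ _ D1 D2.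
  have := @is_deriveZ _ _ _ _ (1 - a)^-1 _ _ _ D3.
  set G := (X in is_derive _ _ X _); set H := (X in _ -> is_derive _ _ X _).
  have -> : G = H by apply/funext => y; rewrite /G /H /= mulrC.
  move=> /is_derive_eq; apply.
  by rewrite mulr1 -[LHS]/(_^-1 * (_ * _)) mulKf// subr_eq0 lt_eqF.
rewrite (@ge0_continuous_FTC2y _ _ F 0 0) ?ltry//.
- by move=> x x0; rewrite powR_ge0.
- apply: continuous_in_subspaceT => x; rewrite inE/= in_itv/= andbT => x0.
  have x1 : 0 < 1 + x by rewrite ltr_pwDl.
  apply: (@continuous_comp _ _ _ (fun y : R => 1 + y) (fun y => y `^ (- a))).
    by apply: (@cvgD _ R^o R^o); [exact: cvg_cst|exact: cvg_id].
  apply: differentiable_continuous; apply/derivable1_diffP.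
  by have [] := is_derive1_powR (- a) x1.
- rewrite -[X in _ --> X](mul0r (1 - a)^-1); apply: cvgMr_tmp.
  apply/cvgrPdist_le => e e0; near=> x.
  have xM : e `^ (- (a - 1)^-1) <= 1 + x.
    rewrite -lerBlDl; near: x; exact: nbhs_pinfty_ge.
  rewrite sub0r normrN ger0_norm ?powR_ge0// -[1 - a]opprB powRN.
  rewrite -[e]invrK lef_pV2 ?posrE ?invr_gt0// ?powR_gt0//; last first.
    by apply: lt_le_trans xM; rewrite powR_gt0.
  have -> : e^-1 = (e `^ (- (a - 1)^-1)) `^ (a - 1).
    by rewrite -powRrM mulNr mulVf ?gt_eqF// powR_inv1// ltW.
  by apply: ge0_ler_powR => //; rewrite ?nnegrE ?powR_ge0// ?(ltW a10)//;
    apply: le_trans xM; rewrite powR_ge0.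
- by move=> x x0; have [] := D x (ltW x0).
- apply: cvg_at_right_filter.
  apply: differentiable_continuous; apply/derivable1_diffP.
  by have [] := D 0 (lexx _).
- move=> x; rewrite in_itv/= andbT => x0.
  by rewrite derive1E; have [_ ->] := D x (ltW x0).
Unshelve. all: by end_near. Qed.

End Japanese.

(** * Weighted spaces on the frequency side *)

Section Weighted.
Context {R : realType}.
Local Notation leb := (@lebesgue_measure R).
Local Notation cmeasR f := (@cmeasurable R _ (measurableTypeR R) f).
Implicit Types (x s t : R) (g : R -> R[i]).

Lemma continuous_japanese_powR s : continuous (fun x : R => japanese x `^ s).
Proof.
move=> x; apply: (@continuous_comp _ _ _ (@japanese R) (fun y => y `^ s)).
  exact: continuous_japanese.
apply: differentiable_continuous; apply/derivable1_diffP.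
by have [] := is_derive1_powR s (japanese_gt0 x).
Qed.

Lemma japanese_ge_half x : 0 <= x -> (1 + x) / 2 <= japanese x.
Proof.
move=> x0; rewrite /japanese -[leLHS]ger0_norm ?divr_ge0 ?addr_ge0//.
rewrite -sqrtr_sqr ler_wsqrtr//; nra.
Qed.

(** The bracket is even and at least [(1 + x) / 2] on the half line. *)
Lemma japanese_powR_lty (a : R) : 1 < a ->
  (\int[leb]_x (japanese x `^ (- a))%:E < +oo)%E.
Proof.
move=> a1; rewrite ge0_symfun_integralT.
- rewrite lte_mul_pinfty//.
  have -> : [set x : R | 0 <= x] = `[0, +oo[%classic by rewrite set_itvcy.
  apply: (@le_lt_trans _ _
    (\int[leb]_(x in `[0%R, +oo[) ((2^-1 `^ (- a))%:E * ((1 + x) `^ (- a))%:E)%E)%E).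
    apply: ge0_le_integral => //.
    - by move=> x _; rewrite lee_fin powR_ge0.
    - apply/measurable_EFinP/measurable_funTS.
      exact: measurable_japanese_powR.
    - apply: measurable_funeM; apply/measurable_EFinP/measurable_funTS.
      exact: (measurableT_comp (measurable_powR _) (@measurable_funD _ _ _ _ (cst 1) id _ _)).
    - move=> x /=; rewrite in_itv/= andbT => x0.
      have x1 : 0 < 1 + x by rewrite ltr_pwDl.
      rewrite -EFinM lee_fin -powRM ?invr_ge0 ?(ltW x1)// !powRN.
      rewrite lef_pV2 ?posrE ?powR_gt0 ?japanese_gt0 ?mulr_gt0//.
      apply: ge0_ler_powR; rewrite ?nnegrE ?(ltW (japanese_gt0 _))//.
      - by rewrite (le_trans _ (ltW a1)).
      - by rewrite mulr_ge0// ltW.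
      - by rewrite mulrC japanese_ge_half.
  rewrite ge0_integralZl//.
  - by rewrite lte_mul_pinfty ?lee_fin ?powR_ge0 ?integrable_onex_powR.
  - apply/measurable_EFinP/measurable_funTS.
    exact: (measurableT_comp (measurable_powR _) (@measurable_funD _ _ _ _ (cst 1) id _ _)).
  - by move=> x _; exact: powR_ge0.
- by move=> x; exact: powR_ge0.
- exact: continuous_japanese_powR.
- by move=> x /=; rewrite japaneseN.
Qed.

Definition weighted t g x : R := japanese x `^ t * cmod (g x).

(** [in_hs s g] says that [g] can be the transform of an element of the Sobolev
    space of order [s]. *)
Definition in_hs s g : Prop := in_L2 (sobolev_weight s g).

Definition hs_norm s g : R := fine (normL2 (sobolev_weight s g)).

Lemma hs_norm_ge0 s g : 0 <= hs_norm s g.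
Proof. by rewrite fine_ge0// normL2_ge0. Qed.

Lemma hs_normE s g : in_hs s g ->
  normL2 (sobolev_weight s g) = (hs_norm s g)%:E.
Proof. by move=> [_ goo]; rewrite /hs_norm fineK// ge0_fin_numE ?normL2_ge0. Qed.

Lemma cmeasurable_weight s g : cmeasR g -> cmeasR (sobolev_weight s g).
Proof.
move=> mg; apply: cmeasurableM => //; apply: cmeasurable_real.
exact: measurable_japanese_powR.
Qed.

(** The weight never vanishes, so it can be divided out. *)
Lemma in_hs_measurable s g : in_hs s g -> cmeasR g.
Proof.
move=> [/(cmeasurable_weight (- s)) mg _].
suff -> : g = sobolev_weight (- s) (sobolev_weight s g) by [].
apply/funext => x; rewrite /sobolev_weight mulrA -rmorphM/=.
by rewrite powRN mulVf ?mul1r// gt_eqF// powR_gt0// japanese_gt0.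
Qed.

Lemma cmod_sobolev_weight s g x :
  cmod (sobolev_weight s g x) = weighted s g x.
Proof. by rewrite cmodM cmod_real ger0_norm ?powR_ge0. Qed.

Lemma in_hsD s f g : in_hs s f -> in_hs s g -> in_hs s (fun x => f x + g x).
Proof.
move=> hf hg; rewrite /in_hs.
have -> : sobolev_weight s (fun x => f x + g x) =
  (fun x => sobolev_weight s f x + sobolev_weight s g x).
  by apply/funext => x; rewrite /sobolev_weight mulrDr.
exact: in_L2D.
Qed.

Lemma sobolev_weightZ s (a : R[i]) g :
  sobolev_weight s (fun x => a * g x) = (fun x => a * sobolev_weight s g x).
Proof. by apply/funext => x; rewrite /sobolev_weight mulrCA. Qed.

Lemma in_hsZ s (a : R[i]) g : in_hs s g -> in_hs s (fun x => a * g x).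
Proof. by move=> hg; rewrite /in_hs sobolev_weightZ; exact: in_L2Z. Qed.

Lemma hs_normZ s (a : R[i]) g : in_hs s g ->
  hs_norm s (fun x => a * g x) = cmod a * hs_norm s g.
Proof.
move=> hg; rewrite /hs_norm sobolev_weightZ normL2Z; last by case: hg.
by rewrite fineM// hs_normE.
Qed.

Lemma hs_norm_ae s f g : in_hs s f -> cmeasR g ->
  {ae leb, forall x, f x = g x} -> in_hs s g /\ hs_norm s g = hs_norm s f.
Proof.
move=> hf mg fg.
have e : normL2 (sobolev_weight s f) = normL2 (sobolev_weight s g).
  apply: normL2_ae; [by case: hf|exact: cmeasurable_weight|].
  by apply: ae_imply fg => x fgx; rewrite /sobolev_weight fgx.
split; last by rewrite /hs_norm e.
by split; [exact: cmeasurable_weight|rewrite -e; case: hf].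
Qed.

Lemma weighted_le t s g x : t <= s -> weighted t g x <= weighted s g x.
Proof.
by move=> ts; rewrite ler_wpM2r ?cmod_ge0// ler_powR// japanese_ge1.
Qed.

(** Cauchy-Schwarz against a negative power of the bracket, which is square
    integrable as soon as its exponent is below -1/2. *)
Lemma weighted_L1 t s : t + 2^-1 < s -> exists2 A : R, 0 <= A &
  forall g, in_hs s g ->
    (\int[leb]_x (cmod (sobolev_weight t g x))%:E <= (A * hs_norm s g)%:E)%E.
Proof.
move=> ts; pose k x : R[i] := (japanese x `^ (t - s))%:C.
have koo : (normL2 k < +oo)%E.
  apply/normL2_lty; rewrite /energy.
  have -> : (fun x => (cmod (k x) ^+ 2)%:E) =
      (fun x : R => (japanese x `^ (- (2 * (s - t))))%:E).
    apply/funext => x; rewrite cmod_real ger0_norm ?powR_ge0//.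
    by rewrite -powR_mulrn ?powR_ge0// -powRrM -mulrN opprB mulrC.
  by apply: japanese_powR_lty; lra.
have mk : cmeasR k by apply: cmeasurable_real; exact: measurable_japanese_powR.
have kE : normL2 k = (fine (normL2 k))%:E.
  by rewrite fineK// ge0_fin_numE ?normL2_ge0.
exists (fine (normL2 k)); first by rewrite fine_ge0 ?normL2_ge0.
move=> g hg; have mg := in_hs_measurable hg.
rewrite EFinM -hs_normE// -kE.
apply: le_trans (cauchy_schwarz mk (cmeasurable_weight s mg)).
rewrite le_eqVlt; apply/orP; left; apply/eqP; apply: eq_integral => x _ /=.
rewrite cmod_real ger0_norm ?powR_ge0// !cmod_sobolev_weight /weighted.
by rewrite mulrA -powRD ?subrK// (gt_eqF (japanese_gt0 x)) implybT.
Qed.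

Lemma weighted_L2 t s g : t <= s -> in_hs s g ->
  (normL2 (sobolev_weight t g) <= (hs_norm s g)%:E)%E.
Proof.
move=> ts hg; have mg := in_hs_measurable hg; rewrite -hs_normE//.
apply: le_normL2; [exact: cmeasurable_weight|exact: cmeasurable_weight|].
by move=> x; rewrite !cmod_sobolev_weight weighted_le.
Qed.

End Weighted.

(** * The exchanges of frequencies *)

Section ChangeOfVariables.
Context {R : realType}.
Local Notation leb := (@lebesgue_measure R).
Local Notation leb2 := (leb \x leb)%E.
Local Notation RR := (measurableTypeR R * measurableTypeR R)%type.
Local Open Scope ereal_scope.

Lemma measurable_reflect (c : R) :
  measurable_fun setT
    (fun x : measurableTypeR R => (c - x)%R : measurableTypeR R).
Proof. by apply: measurable_funB. Qed.

Lemma ge0_integral_reflect (c : R) (f : R -> \bar R) :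
  measurable_fun setT f -> (forall x, 0 <= f x) ->
  \int[leb]_x f (c - x)%R = \int[leb]_x f x.
Proof.
move=> mf f0.
pose phi (x : measurableTypeR R) : measurableTypeR R := (c - x)%R.
have mphi : measurable_fun setT phi by exact: measurable_reflect.
rewrite -[LHS](ge0_integral_pushforward mphi leb measurableT mf)//.
apply: eq_measure_integral => A mA _.
apply/esym; apply: lebesgue_measure_unique => // _ [[a b]] _ <-.
change (leb `]a, b]%classic = leb (phi @^-1` `]a, b]%classic)).
rewrite (_ : phi @^-1` _ = `[(c - b)%R, (c - a)%R[%classic); last first.
  rewrite /phi; apply/seteqP; split => x /=; rewrite !in_itv/= => /andP[? ?]; apply/andP; split; lra.
rewrite !lebesgue_measure_itv/= !lte_fin ltrD2l ltrN2.
by case: ifPn => // _; rewrite -!EFinB; congr EFin; lra.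
Qed.

Lemma ge0_integral_shift (c : R) (f : R -> \bar R) :
  measurable_fun setT f -> (forall x, 0 <= f x) ->
  \int[leb]_x f (x - c)%R = \int[leb]_x f x.
Proof.
move=> mf f0; pose g (y : R) := f (0 - y)%R.
transitivity (\int[leb]_x g (c - x)%R).
  by apply: eq_integral => x _; rewrite /g sub0r opprB.
rewrite ge0_integral_reflect//; first exact: ge0_integral_reflect.
  exact: (measurableT_comp mf (measurable_reflect 0)).
by move=> x; exact: f0.
Qed.

(** Of the frequencies [- z.1], [z.1 - z.2], [z.2], whose sum is zero, the map
    [swap23] exchanges the last two and [swap12] the first two. *)
Definition swap23 (z : RR) : RR := (z.1, z.1 - z.2)%R.
Definition swap12 (z : RR) : RR := (z.2 - z.1, z.2)%R.

Lemma measurable_swap23 : measurable_fun setT swap23.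
Proof.
apply: measurable_fun_pair => //.
by apply: measurable_funB; [exact: measurable_fst|exact: measurable_snd].
Qed.

Lemma measurable_swap12 : measurable_fun setT swap12.
Proof.
apply: measurable_fun_pair; last exact: measurable_snd.
by apply: measurable_funB; [exact: measurable_snd|exact: measurable_fst].
Qed.

(** For a fixed first coordinate the map is a reflection of the line. *)
Lemma ge0_integral_swap23 (f : RR -> \bar R) :
  measurable_fun setT f -> (forall z, 0 <= f z) ->
  \int[leb2]_z f (swap23 z) = \int[leb2]_z f z.
Proof.
move=> mf f0; rewrite (fubini_tonelli1 f)// (fubini_tonelli1 (f \o swap23))//.
- apply: eq_integral => x _; rewrite /fubini_F /= /swap23 /=.
  apply: (ge0_integral_reflect x (f := fun y => f (x, y))) => //.
  exact: measurable_fun_pair2.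
- exact: (measurableT_comp mf measurable_swap23).
- by move=> z; exact: f0.
Qed.

Lemma ge0_integral_swap12 (f : RR -> \bar R) :
  measurable_fun setT f -> (forall z, 0 <= f z) ->
  \int[leb2]_z f (swap12 z) = \int[leb2]_z f z.
Proof.
move=> mf f0; rewrite (fubini_tonelli2 f)// (fubini_tonelli2 (f \o swap12))//.
- apply: eq_integral => y _; rewrite /fubini_G /= /swap12 /=.
  apply: (ge0_integral_reflect y (f := fun x => f (x, y))) => //.
  exact: measurable_fun_pair1.
- exact: (measurableT_comp mf measurable_swap12).
- by move=> z; exact: f0.
Qed.

(** Only nonnegative functions occur, where Tonelli applies without integrability
    assumption; the next lemmas extend this to complex functions and to null
    sets. *)
Definition preserves_leb2 (phi : RR -> RR) : Prop :=
  measurable_fun setT phi /\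
  forall f : RR -> \bar R, measurable_fun setT f -> (forall z, 0 <= f z) ->
    \int[leb2]_z f (phi z) = \int[leb2]_z f z.

Lemma preserves_swap23 : preserves_leb2 swap23.
Proof. by split; [exact: measurable_swap23|exact: ge0_integral_swap23]. Qed.

Lemma preserves_swap12 : preserves_leb2 swap12.
Proof. by split; [exact: measurable_swap12|exact: ge0_integral_swap12]. Qed.

Lemma preserves_integral phi (f : RR -> \bar R) : preserves_leb2 phi ->
  measurable_fun setT f -> \int[leb2]_z f (phi z) = \int[leb2]_z f z.
Proof.
move=> [mphi H] mf; rewrite integralE [RHS]integralE; congr (_ - _).
  rewrite -(H _ (measurable_funepos mf) (funepos_ge0 f)).
  by apply: eq_integral => z _; rewrite !funeposE.
rewrite -(H _ (measurable_funeneg mf) (funeneg_ge0 f)).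
by apply: eq_integral => z _; rewrite !funenegE.
Qed.

Lemma preserves_cintegral phi (f : RR -> R[i]) : preserves_leb2 phi ->
  cmeasurable f -> cintegral leb2 (fun z => f (phi z)) = cintegral leb2 f.
Proof.
move=> H [f1 f2]; rewrite /cintegral /Rintegral; congr (fine _ +i* fine _).
  apply: (preserves_integral (f := fun z => (complex.Re (f z))%:E)) => //.
  exact/measurable_EFinP.
apply: (preserves_integral (f := fun z => (complex.Im (f z))%:E)) => //.
exact/measurable_EFinP.
Qed.

Lemma preserves_ae phi (P : RR -> Prop) : preserves_leb2 phi ->
  {ae leb2, forall z, P z} -> {ae leb2, forall z, P (phi z)}.
Proof.
move=> [mphi H] [N [mN N0 PN]].
have mphiN : measurable (phi @^-1` N).
  by rewrite -[X in measurable X]setTI; exact: mphi.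
exists (phi @^-1` N); split => //; last by move=> z /= nP; apply: PN.
rewrite -N0 -[phi @^-1` N]setIT -[in RHS](setIT N).
rewrite -integral_indic// -[RHS]integral_indic//.
rewrite -(H (fun z => (\1_N z)%:E))//.
exact/measurable_EFinP/measurable_indic.
Qed.

End ChangeOfVariables.

(** * The trilinear form *)

Section Trilinear.
Context {R : realType}.
Local Notation leb := (@lebesgue_measure R).
Local Notation leb2 := (leb \x leb)%E.
Local Notation RR := (measurableTypeR R * measurableTypeR R)%type.
Local Notation cmeasR f := (@cmeasurable R _ (measurableTypeR R) f).
Implicit Types (f g h : R -> R[i]) (m : RR -> R[i]).

Definition freq_product f g h (z : RR) : R[i] :=
  f (- z.1) * g (z.1 - z.2) * h z.2.

Definition trilinear m f g h : R[i] :=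
  cintegral leb2 (fun z => m z * freq_product f g h z).

Lemma measurable_freq1 : measurable_fun setT (fun z : RR => - z.1 : measurableTypeR R).
Proof. exact: measurableT_comp. Qed.

Lemma measurable_freq2 :
  measurable_fun setT (fun z : RR => z.1 - z.2 : measurableTypeR R).
Proof. by apply: measurable_funB; [exact: measurable_fst|exact: measurable_snd]. Qed.

Lemma measurable_freq3 : measurable_fun setT (fun z : RR => z.2 : measurableTypeR R).
Proof. exact: measurable_snd. Qed.

Lemma cmeasurable_freq_product f g h : cmeasR f -> cmeasR g -> cmeasR h ->
  cmeasurable (freq_product f g h).
Proof.
move=> mf mg mh; apply: cmeasurableM; first apply: cmeasurableM.
- exact: (cmeasurable_comp mf measurable_freq1).
- exact: (cmeasurable_comp mg measurable_freq2).
- exact: (cmeasurable_comp mh measurable_freq3).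
Qed.

Lemma normL2_reflect (c : R) f : cmeasR f ->
  normL2 (fun x => f (c - x)) = normL2 f.
Proof.
move=> mf; rewrite !normL2_energy; congr (_ `^ _)%E.
apply: (ge0_integral_reflect c (f := fun x => (cmod (f x) ^+ 2)%:E)).
- exact/measurable_EFinP/measurable_funX/measurable_cmod.
- by move=> x; rewrite lee_fin sqr_ge0.
Qed.

Lemma normL2_shift (c : R) f : cmeasR f ->
  normL2 (fun x => f (x - c)) = normL2 f.
Proof.
move=> mf; rewrite !normL2_energy; congr (_ `^ _)%E.
apply: (ge0_integral_shift c (f := fun x => (cmod (f x) ^+ 2)%:E)).
- exact/measurable_EFinP/measurable_funX/measurable_cmod.
- by move=> x; rewrite lee_fin sqr_ge0.
Qed.

(** For fixed [eta], Cauchy-Schwarz in [xi] bounds the integral of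
    [|f (- xi) g (xi - eta)|] by the product of the [L^2] norms, which does not
    depend on [eta]; the factor [|h eta|] is then integrated. *)
Lemma freq_product_L1 f g h (a b c : R) : 0 <= b ->
  cmeasR f -> cmeasR g -> cmeasR h ->
  (normL2 f <= a%:E)%E -> (normL2 g <= b%:E)%E ->
  (\int[leb]_x (cmod (h x))%:E <= c%:E)%E ->
  (\int[leb2]_z (cmod (freq_product f g h z))%:E <= (a * b * c)%:E)%E.
Proof.
move=> b0 mf mg mh fa gb hc.
have a0 : 0 <= a by rewrite -lee_fin (le_trans (normL2_ge0 f)).
have ab0 : 0 <= a * b by rewrite mulr_ge0.
rewrite (fubini_tonelli2 (fun z => (cmod (freq_product f g h z))%:E)); last 2 first.
- exact/measurable_EFinP/measurable_cmod/cmeasurable_freq_product.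
- by move=> z; rewrite lee_fin cmod_ge0.
have mnf : cmeasR (fun x => f (- x)).
  by apply: (cmeasurable_comp mf); exact: oppr_measurable.
apply: (@le_trans _ _ (\int[leb]_y ((a * b)%:E * (cmod (h y))%:E))%E); last first.
  rewrite ge0_integralZl ?lee_fin//.
  - by rewrite [leRHS]EFinM lee_wpmul2l ?lee_fin.
  - exact/measurable_EFinP/measurable_cmod.
  - by move=> x _; rewrite lee_fin cmod_ge0.
apply: ge0_le_integral => //.
- by move=> y _; apply: integral_ge0 => x _; rewrite lee_fin cmod_ge0.
- apply: (measurable_fun_fubini_tonelli_G
    (fun z => (cmod (freq_product f g h z))%:E)).
  + exact/measurable_EFinP/measurable_cmod/cmeasurable_freq_product.
  + by move=> z; rewrite lee_fin cmod_ge0.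
- by apply: measurable_funeM; exact/measurable_EFinP/measurable_cmod.
move=> y _; rewrite /fubini_G /freq_product /=.
have mgy : cmeasR (fun x => g (x - y)).
  by apply: (cmeasurable_comp mg); apply: measurable_funB.
rewrite (eq_integral (fun x : measurableTypeR R =>
  (cmod (h y))%:E * (cmod (f (- x)) * cmod (g (x - y)))%:E)%E); last first.
  by move=> x _; rewrite !cmodM mulrC EFinM.
rewrite ge0_integralZl ?lee_fin ?cmod_ge0//; last 2 first.
- by apply/measurable_EFinP/measurable_funM; apply: measurable_cmod.
- by move=> x _; rewrite lee_fin mulr_ge0 ?cmod_ge0.
rewrite muleC lee_wpmul2r ?lee_fin ?cmod_ge0//.
apply: le_trans (cauchy_schwarz mnf mgy) _.
rewrite normL2_shift//.
have -> : normL2 (fun x => f (- x)) = normL2 f.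
  rewrite -(normL2_reflect 0 mf); congr normL2.
  by apply/funext => x; rewrite sub0r.
by rewrite EFinM lee_pmul ?normL2_ge0.
Qed.

(** The bound is symmetric in the three frequencies, hence invariant under
    [swap12] and [swap23]. *)
Definition admissible t m : Prop :=
  cmeasurable m /\ exists2 C : R, 0 <= C & forall z, cmod (m z) <=
    C * (japanese z.1 `^ t * japanese (z.1 - z.2) `^ t * japanese z.2 `^ t).

Lemma admissible_le t m f g h (C : R) z : 
  cmod (m z) <=
    C * (japanese z.1 `^ t * japanese (z.1 - z.2) `^ t * japanese z.2 `^ t) ->
  cmod (m z * freq_product f g h z) <= C *
    cmod (freq_product (sobolev_weight t f) (sobolev_weight t g)
      (sobolev_weight t h) z).
Proof.
move=> mC; rewrite cmodM.
apply: le_trans (ler_wpM2r (cmod_ge0 _) mC) _.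
rewrite /freq_product !cmodM !cmod_real !ger0_norm ?powR_ge0// japaneseN.
by rewrite le_eqVlt; apply/orP; left; apply/eqP; ring.
Qed.

End Trilinear.

Section TrilinearTheory.
Context {R : realType}.
Local Notation leb := (@lebesgue_measure R).
Local Notation leb2 := (leb \x leb)%E.
Local Notation RR := (measurableTypeR R * measurableTypeR R)%type.
Local Notation cmeasR f := (@cmeasurable R _ (measurableTypeR R) f).
Implicit Types (f g h : R -> R[i]) (m : RR -> R[i]).

Lemma cintegral_fubini (F : RR -> R[i]) : cintegrable leb2 F ->
  (forall x, cintegrable leb (fun y => F (x, y))) ->
  cintegral leb2 F = cintegral leb (fun x => cintegral leb (fun y => F (x, y))).
Proof.
move=> [F1 F2] FX; apply: complex_ext; rewrite /= /Rintegral; congr fine.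
  rewrite -(integral12_prod_meas1 F1); apply: eq_integral => x _.
  have [FX1 _] := FX x; rewrite /fubini_F /= /Rintegral fineK//.
  exact: integrable_fin_num FX1.
rewrite -(integral12_prod_meas1 F2); apply: eq_integral => x _.
have [_ FX2] := FX x; rewrite /fubini_F /= /Rintegral fineK//.
exact: integrable_fin_num FX2.
Qed.

Lemma cmeasurable_section (F : RR -> R[i]) (x : R) : cmeasurable F ->
  cmeasR (fun y => F (x, y)).
Proof. by move=> mF; apply: (cmeasurable_comp mF); exact: pair1_measurable. Qed.

Section Admissible.
Variables (t : R).

Lemma admissibleD m1 m2 : admissible t m1 -> admissible t m2 ->
  admissible t (fun z => m1 z + m2 z).
Proof.
move=> [mm1 [C1 C10 H1]] [mm2 [C2 C20 H2]]; split; first exact: cmeasurableD.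
exists (C1 + C2); first exact: addr_ge0.
move=> z; apply: le_trans (cmodD _ _) _.
by rewrite mulrDl lerD.
Qed.

Lemma admissibleZ (a : R[i]) m : admissible t m ->
  admissible t (fun z => a * m z).
Proof.
move=> [mm [C C0 H]]; split.
  by apply: cmeasurableM => //; exact: cmeasurable_cst.
exists (cmod a * C); first by rewrite mulr_ge0 ?cmod_ge0.
by move=> z; rewrite cmodM -mulrA ler_wpM2l ?cmod_ge0.
Qed.

Lemma admissible_swap23 m : admissible t m -> admissible t (m \o swap23).
Proof.
move=> [mm [C C0 H]]; split.
  exact: (cmeasurable_comp mm (@measurable_swap23 R)).
exists C => // z; apply: le_trans (H _) _; rewrite /swap23 /=.
have -> : z.1 - (z.1 - z.2) = z.2 by ring.
by rewrite mulrAC.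
Qed.

Lemma admissible_swap12 m : admissible t m -> admissible t (m \o swap12).
Proof.
move=> [mm [C C0 H]]; split.
  exact: (cmeasurable_comp mm (@measurable_swap12 R)).
exists C => // z; apply: le_trans (H _) _; rewrite /swap12 /=.
have -> : z.2 - z.1 - z.2 = - z.1 by ring.
rewrite -(opprB z.1 z.2) !japaneseN.
by rewrite le_eqVlt; apply/orP; left; apply/eqP; ring.
Qed.

Lemma freq_product_swap23 f g h z :
  freq_product f g h (swap23 z) = freq_product f h g z.
Proof.
rewrite /freq_product /swap23 /=.
have -> : z.1 - (z.1 - z.2) = z.2 by ring.
by rewrite mulrAC.
Qed.

Lemma freq_product_swap12 f g h z :
  freq_product f g h (swap12 z) = freq_product g f h z.
Proof.
rewrite /freq_product /swap12 /=.
have -> : z.2 - z.1 - z.2 = - z.1 by ring.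
by rewrite opprB; ring.
Qed.

End Admissible.

Section Bounds.
Variables (t s : R).
Hypothesis ts : t + 2^-1 < s.

Let le_ts : t <= s.
Proof. by apply: ltW; apply: lt_trans ts; rewrite ltrDl invr_gt0. Qed.

(** The third factor is weighted from [L^2] into [L^1], which is where the
    exponent has to exceed [t] by more than one half. *)
Lemma freq_product_hs_L1 : exists2 A : R, 0 <= A & forall f g h,
  in_hs s f -> in_hs s g -> in_hs s h ->
  (\int[leb2]_z (cmod (freq_product (sobolev_weight t f) (sobolev_weight t g)
      (sobolev_weight t h) z))%:E
    <= (A * (hs_norm s f * hs_norm s g * hs_norm s h))%:E)%E.
Proof.
have [A A0 HA] := weighted_L1 ts; exists A => // f g h hf hg hh.
have -> : A * (hs_norm s f * hs_norm s g * hs_norm s h) =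
  hs_norm s f * hs_norm s g * (A * hs_norm s h) by ring.
apply: freq_product_L1; rewrite ?hs_norm_ge0 ?HA ?weighted_L2//;
  by apply: cmeasurable_weight; apply: in_hs_measurable; eassumption.
Qed.

Lemma trilinear_le m : admissible t m -> exists2 K : R, 0 <= K &
  forall f g h, in_hs s f -> in_hs s g -> in_hs s h ->
  (\int[leb2]_z (cmod (m z * freq_product f g h z))%:E
    <= (K * (hs_norm s f * hs_norm s g * hs_norm s h))%:E)%E.
Proof.
move=> [mm [C C0 HC]]; have [A A0 HA] := freq_product_hs_L1.
exists (C * A); first exact: mulr_ge0.
move=> f g h hf hg hh.
have mw := cmeasurable_freq_product (cmeasurable_weight t (in_hs_measurable hf))
  (cmeasurable_weight t (in_hs_measurable hg))
  (cmeasurable_weight t (in_hs_measurable hh)).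
have mfp := cmeasurable_freq_product (in_hs_measurable hf)
  (in_hs_measurable hg) (in_hs_measurable hh).
rewrite -mulrA EFinM; apply: le_trans (lee_wpmul2l _ (HA _ _ _ hf hg hh)).
  rewrite -ge0_integralZl ?lee_fin//; last 2 first.
  - exact/measurable_EFinP/measurable_cmod.
  - by move=> z _; rewrite lee_fin cmod_ge0.
  apply: ge0_le_integral => //.
  - by move=> z _; rewrite lee_fin cmod_ge0.
  - exact/measurable_EFinP/measurable_cmod/cmeasurableM.
  - by apply: measurable_funeM; exact/measurable_EFinP/measurable_cmod.
  - by move=> z _; rewrite -EFinM lee_fin; apply: admissible_le.
by rewrite lee_fin.
Qed.

Lemma trilinear_integrable m f g h : admissible t m ->
  in_hs s f -> in_hs s g -> in_hs s h ->
  cintegrable leb2 (fun z => m z * freq_product f g h z).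
Proof.
move=> am hf hg hh; have [K K0 HK] := trilinear_le am.
apply: cintegrable_lty; last by apply: le_lt_trans (HK _ _ _ hf hg hh) (ltry _).
case: am => mm _; apply: cmeasurableM => //.
by apply: cmeasurable_freq_product; apply: in_hs_measurable; eassumption.
Qed.

Lemma trilinear_bound m : admissible t m -> exists2 K : R, 0 <= K &
  forall f g h, in_hs s f -> in_hs s g -> in_hs s h ->
  cmod (trilinear m f g h) <= K * (hs_norm s f * hs_norm s g * hs_norm s h).
Proof.
move=> am; have [K K0 HK] := trilinear_le am.
exists (2 * K); first by rewrite mulr_ge0.
move=> f g h hf hg hh; rewrite -mulrA.
by apply: cmod_cintegral_le; [exact: trilinear_integrable|exact: HK].
Qed.

Lemma trilinear_linear1 m (a : R[i]) f1 f2 g h : admissible t m ->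
  in_hs s f1 -> in_hs s f2 -> in_hs s g -> in_hs s h ->
  trilinear m (fun x => a * f1 x + f2 x) g h =
  a * trilinear m f1 g h + trilinear m f2 g h.
Proof.
move=> am hf1 hf2 hg hh; rewrite /trilinear -cintegralZl; last first.
  exact: trilinear_integrable.
rewrite -cintegralD; [|exact/cintegrableZl/trilinear_integrable|
  exact: trilinear_integrable].
by apply: eq_cintegral => z; rewrite /freq_product; ring.
Qed.

Lemma trilinear_symbolD m1 m2 f g h : admissible t m1 -> admissible t m2 ->
  in_hs s f -> in_hs s g -> in_hs s h ->
  trilinear (fun z => m1 z + m2 z) f g h = trilinear m1 f g h + trilinear m2 f g h.
Proof.
move=> am1 am2 hf hg hh; rewrite /trilinear -cintegralD;
  [|exact: trilinear_integrable..].
by apply: eq_cintegral => z; ring.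
Qed.

Lemma trilinear_symbolZ m (a : R[i]) f g h : admissible t m ->
  in_hs s f -> in_hs s g -> in_hs s h ->
  trilinear (fun z => a * m z) f g h = a * trilinear m f g h.
Proof.
move=> am hf hg hh; rewrite /trilinear -cintegralZl; last first.
  exact: trilinear_integrable.
by apply: eq_cintegral => z; ring.
Qed.

Lemma trilinear_swap23 m f g h : admissible t m ->
  in_hs s f -> in_hs s g -> in_hs s h ->
  trilinear m f g h = trilinear (m \o swap23) f h g.
Proof.
move=> am hf hg hh.
rewrite /trilinear -(preserves_cintegral (@preserves_swap23 R)).
  by apply: eq_cintegral => z; rewrite freq_product_swap23.
exact/cmeasurable_integrable/trilinear_integrable.
Qed.

Lemma trilinear_swap12 m f g h : admissible t m ->
  in_hs s f -> in_hs s g -> in_hs s h ->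
  trilinear m f g h = trilinear (m \o swap12) g f h.
Proof.
move=> am hf hg hh.
rewrite /trilinear -(preserves_cintegral (@preserves_swap12 R)).
  by apply: eq_cintegral => z; rewrite freq_product_swap12.
exact/cmeasurable_integrable/trilinear_integrable.
Qed.

(** The exchange of the first two slots reduces this to linearity in the first
    one, and similarly for the third slot below. *)
Lemma trilinear_linear2 m (a : R[i]) f g1 g2 h : admissible t m ->
  in_hs s f -> in_hs s g1 -> in_hs s g2 -> in_hs s h ->
  trilinear m f (fun x => a * g1 x + g2 x) h =
  a * trilinear m f g1 h + trilinear m f g2 h.
Proof.
move=> am hf hg1 hg2 hh.
have hg : in_hs s (fun x => a * g1 x + g2 x) by apply: in_hsD => //; exact: in_hsZ.
rewrite trilinear_swap12// trilinear_linear1//; last exact: admissible_swap12.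
by rewrite -!trilinear_swap12.
Qed.

Lemma trilinear_linear3 m (a : R[i]) f g h1 h2 : admissible t m ->
  in_hs s f -> in_hs s g -> in_hs s h1 -> in_hs s h2 ->
  trilinear m f g (fun x => a * h1 x + h2 x) =
  a * trilinear m f g h1 + trilinear m f g h2.
Proof.
move=> am hf hg hh1 hh2.
have hh : in_hs s (fun x => a * h1 x + h2 x) by apply: in_hsD => //; exact: in_hsZ.
rewrite trilinear_swap23// trilinear_linear2//; last exact: admissible_swap23.
by rewrite -!trilinear_swap23.
Qed.

(** For fixed [xi] the inner integrand is integrable, as a product of two
    square integrable functions. *)
Lemma section_integrable m g h x : admissible t m ->
  in_hs s g -> in_hs s h ->
  cintegrable leb (fun y => m (x, y) * (g (x - y) * h y)).
Proof.
move=> [mm [C C0 HC]] hg hh.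
have mg := in_hs_measurable hg; have mh := in_hs_measurable hh.
have mwg := cmeasurable_weight t mg; have mwh := cmeasurable_weight t mh.
pose wg y := sobolev_weight t g (x - y).
have mxg : cmeasR wg.
  by apply: (cmeasurable_comp mwg); apply: measurable_reflect.
apply: (@cintegrable_le _ (measurableTypeR R) R leb _
    (fun y => (C * japanese x `^ t) * (cmod (wg y) * cmod (sobolev_weight t h y)))).
- apply: cmeasurableM; first exact: cmeasurable_section.
  apply: cmeasurableM => //.
  by apply: (cmeasurable_comp mg); apply: measurable_reflect.
- apply: integrableZl_EFin; apply/integrableP; split.
    by apply/measurable_EFinP/measurable_funM; apply: measurable_cmod.
  under eq_integral do rewrite /= ger0_norm ?mulr_ge0 ?cmod_ge0//.
  apply: le_lt_trans (cauchy_schwarz mxg mwh) _.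
  rewrite normL2_reflect// lte_mul_pinfty ?normL2_ge0//.
    rewrite ge0_fin_numE ?normL2_ge0//.
    exact: le_lt_trans (weighted_L2 le_ts hg) (ltry _).
  exact: le_lt_trans (weighted_L2 le_ts hh) (ltry _).
- move=> y; rewrite cmodM; apply: le_trans (ler_wpM2r (cmod_ge0 _) (HC _)) _.
  rewrite /wg /sobolev_weight !cmodM !cmod_real !ger0_norm ?powR_ge0//=.
  by rewrite le_eqVlt; apply/orP; left; apply/eqP; ring.
Qed.

(** The iterated integral on the right is the shape in which [integral_vN] is
    defined. *)
Lemma trilinear_fubini m f g h : admissible t m ->
  in_hs s f -> in_hs s g -> in_hs s h ->
  trilinear m f g h = cintegral leb (fun x => f (- x) *
    cintegral leb (fun y => m (x, y) * (g (x - y) * h y))).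
Proof.
move=> am hf hg hh; rewrite /trilinear cintegral_fubini.
- apply: eq_cintegral => x; rewrite -cintegralZl; last exact: section_integrable hg hh.
  by apply: eq_cintegral => y; rewrite /freq_product /=; ring.
- exact: trilinear_integrable.
- move=> x.
  have -> : (fun y => m (x, y) * freq_product f g h (x, y)) =
    (fun y => f (- x) * (m (x, y) * (g (x - y) * h y))).
    by apply/funext => y; rewrite /freq_product /=; ring.
  by apply: cintegrableZl; exact: section_integrable hg hh.
Qed.

End Bounds.
End TrilinearTheory.

(** * Linearity of the Fourier transform *)

Section FourierLinear.
Context {R : realType}.
Local Notation leb := (@lebesgue_measure R).
Local Notation RR := (measurableTypeR R * measurableTypeR R)%type.
Local Notation cmeasR f := (@cmeasurable R _ (measurableTypeR R) f).
Implicit Types (u v g h : R -> R[i]).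

Lemma cmeasurable_fubini (F : RR -> R[i]) : cmeasurable F ->
  cmeasR (fun x => cintegral leb (fun y => F (x, y))).
Proof.
have real_part (G : RR -> R) : measurable_fun setT G ->
    measurable_fun setT (fun x => Rintegral leb setT (fun y => G (x, y))).
  move=> mG; apply: (measurableT_comp (fine_measurable measurableT)).
  have -> : (fun x => (\int[leb]_y (G (x, y))%:E)%E) =
      (fubini_F leb (EFin \o G)^\+ \- fubini_F leb (EFin \o G)^\-)%E.
    apply/funext => x; rewrite integralE /fubini_F; congr (_ - _)%E;
      by apply: eq_integral => y _; rewrite ?funeposE ?funenegE.
  have mE : measurable_fun setT (EFin \o G) by exact/measurable_EFinP.
  apply: emeasurable_funB.
    exact: measurable_fun_fubini_tonelli_F (measurable_funepos mE) (funepos_ge0 _).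
  exact: measurable_fun_fubini_tonelli_F (measurable_funeneg mE) (funeneg_ge0 _).
move=> [F1 F2]; split; first exact: (real_part (fun z => complex.Re (F z)) F1).
exact: (real_part (fun z => complex.Im (F z)) F2).
Qed.

Lemma truncateE k u x :
  truncate k u x = (\1_(`[- k%:R, k%:R]%classic : set R) x)%:C * u x.
Proof.
rewrite /truncate indicE mem_setE in_itv/= -ler_norml.
by case: ifP; rewrite ?mul1r ?mul0r.
Qed.

Lemma cmeasurable_truncate k u : cmeasR u -> cmeasR (truncate k u).
Proof.
move=> mu; have -> := funext (truncateE k u).
by apply: cmeasurableM => //; apply: cmeasurable_real; exact: measurable_indic.
Qed.

Lemma truncate_integrable k u xi : in_L2 u ->
  cintegrable leb (fun x => truncate k u x * cis (- (xi * x))).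
Proof.
move=> [mu u2].
have mcis : cmeasR (fun x => cis (- (xi * x))).
  apply: (cmeasurable_comp (@cmeasurable_cis R)).
  exact: measurableT_comp.
apply: cintegrable_lty.
  by apply: cmeasurableM => //; exact: cmeasurable_truncate.
pose I x : R[i] := (\1_(`[- k%:R, k%:R]%classic : set R) x)%:C.
have mI : cmeasR I by apply: cmeasurable_real; exact: measurable_indic.
apply: (@le_lt_trans _ _ (normL2 I * normL2 u)%E).
  apply: le_trans (cauchy_schwarz mI mu).
  rewrite le_eqVlt; apply/orP; left; apply/eqP; apply: eq_integral => x _.
  by rewrite cmodM cmod_cis mulr1 truncateE cmodM.
rewrite lte_mul_pinfty ?normL2_ge0// ge0_fin_numE ?normL2_ge0//.
apply/normL2_lty; rewrite /energy.
rewrite (eq_integral (fun x : measurableTypeR R => (\1_(`[- k%:R, k%:R]%classic : set R) x)%:E)); last first.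
  move=> x _; rewrite cmod_real indicE; case: (_ \in _); rewrite ?normr1 ?normr0.
    by rewrite expr1n.
  by rewrite expr0n.
rewrite integral_indic// setIT.
change (leb [set` `[- k%:R, k%:R]%R] < +oo)%E.
rewrite lebesgue_measure_itv/=.
by case: ifP => // _; rewrite -EFinB ltry.
Qed.

(** Truncated square integrable functions are integrable, so that the transform
    of a truncation is given by an absolutely convergent integral. *)
Lemma fourierL1_linear k (a : R[i]) u v xi : in_L2 u -> in_L2 v ->
  fourierL1 (truncate k (fun x => a * u x + v x)) xi =
  a * fourierL1 (truncate k u) xi + fourierL1 (truncate k v) xi.
Proof.
move=> hu hv; rewrite /fourierL1 mulrCA -mulrDr; congr (_ * _).
rewrite -cintegralZl; last exact: truncate_integrable.
rewrite -cintegralD; [|exact/cintegrableZl/truncate_integrable|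
  exact: truncate_integrable].
apply: eq_cintegral => x; rewrite /truncate; case: ifP => _; ring.
Qed.

Lemma cmeasurable_fourierL1 u : cmeasR u -> cmeasR (fourierL1 u).
Proof.
move=> mu; apply: cmeasurableM; first exact: cmeasurable_cst.
apply: (cmeasurable_fubini (F := fun z => u z.2 * cis (- (z.1 * z.2)))).
apply: cmeasurableM; first exact: (cmeasurable_comp mu measurable_snd).
apply: (cmeasurable_comp (@cmeasurable_cis R)).
apply: measurableT_comp => //.
by apply: measurable_funM; [exact: measurable_fst|exact: measurable_snd].
Qed.

Lemma is_fourier_linear (a : R[i]) u v g h : is_fourier u g -> is_fourier v h ->
  is_fourier (fun x => a * u x + v x) (fun x => a * g x + h x).
Proof.
move=> [hu hg gc] [hv hh hc]; split.
- by apply: in_L2D => //; exact: in_L2Z.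
- by apply: in_L2D => //; exact: in_L2Z.
pose e1 k := normL2 (fun xi => g xi - fourierL1 (truncate k u) xi).
pose e2 k := normL2 (fun xi => h xi - fourierL1 (truncate k v) xi).
have e0 : ((cmod a)%:E * e1 k + e2 k)%E @[k --> \oo] --> 0%E.
  rewrite -[X in _ --> X]adde0 -[X in _ --> (X + _)%E](mule0 (cmod a)%:E).
  apply: cvgeD hc; first by rewrite mule0.
  exact: cvgeZl gc.
apply: (squeeze_cvge _ (cvg_cst 0%E) e0).
apply: nearW => k; rewrite normL2_ge0/=.
have mg' : cmeasR (fun xi => g xi - fourierL1 (truncate k u) xi).
  apply: cmeasurableB; first by case: hg.
  by apply/cmeasurable_fourierL1/cmeasurable_truncate; case: hu.
have mh' : cmeasR (fun xi => h xi - fourierL1 (truncate k v) xi).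
  apply: cmeasurableB; first by case: hh.
  by apply/cmeasurable_fourierL1/cmeasurable_truncate; case: hv.
rewrite /e1 -normL2Z//.
have -> : (fun xi => a * g xi + h xi
      - fourierL1 (truncate k (fun x => a * u x + v x)) xi) =
    (fun xi => a * (g xi - fourierL1 (truncate k u) xi) +
      (h xi - fourierL1 (truncate k v) xi)).
  by apply/funext => xi; rewrite fourierL1_linear//; ring.
apply: normL2D => //.
by apply: cmeasurableM => //; exact: cmeasurable_cst.
Qed.

Lemma is_fourier_unique u g h : is_fourier u g -> is_fourier u h ->
  {ae leb, forall xi, g xi = h xi}.
Proof.
move=> [hu hg gc] [_ hh hc].
have mgh : cmeasR (fun xi => g xi - h xi).
  by apply: cmeasurableB; [case: hg|case: hh].
suff : normL2 (fun xi => g xi - h xi) = 0%E.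
  by move=> /(normL2_eq0 mgh); apply: ae_imply => xi /eqP; rewrite subr_eq0 => /eqP.
apply/eqP; rewrite eq_le normL2_ge0 andbT.
pose e1 k := normL2 (fun xi => g xi - fourierL1 (truncate k u) xi).
pose e2 k := normL2 (fun xi => h xi - fourierL1 (truncate k u) xi).
have e0 : (e1 k + e2 k)%E @[k --> \oo] --> 0%E.
  by rewrite -[X in _ --> X]adde0; exact: cvgeD.
rewrite -(cvg_lim _ e0)//; apply: lime_ge; first exact: (cvgP _ e0).
apply: nearW => k; rewrite /e2 -[X in (_ <= _ + X)%E]normL2N.
have -> : (fun xi => g xi - h xi) = (fun xi =>
    (g xi - fourierL1 (truncate k u) xi) +
    - (h xi - fourierL1 (truncate k u) xi)).
  by apply/funext => xi; ring.
have mF : cmeasR (fourierL1 (truncate k u)).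
  by apply/cmeasurable_fourierL1/cmeasurable_truncate; case: hu.
apply: normL2D.
  by apply: cmeasurableB => //; case: hg.
by apply: cmeasurableN; apply: cmeasurableB => //; case: hh.
Qed.

(** [fourier u] is a choice among the representatives of the transform, so it
    agrees with any other one only almost everywhere. *)
Lemma fourier_ae u g : is_fourier u g ->
  is_fourier u (fourier u) /\ {ae leb, forall xi, g xi = fourier u xi}.
Proof.
move=> ug; have uf : is_fourier u (fourier u).
  by apply: (@xgetPex _ (fun=> 0) [set g | is_fourier u g]); exists g.
by split => //; exact: is_fourier_unique ug uf.
Qed.

Lemma sobolev_of_fourier s u g : is_fourier u g -> in_hs s g -> sobolev s u.
Proof.
move=> ug hg; have [uf gf] := fourier_ae ug; split => //.
have mf : cmeasR (fourier u) by case: uf => _ [].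
by have [] := hs_norm_ae hg mf gf.
Qed.

Lemma sobolev_linear s (a : R[i]) u v : sobolev s u -> sobolev s v ->
  sobolev s (fun x => a * u x + v x) /\
  {ae leb, forall xi, a * fourier u xi + fourier v xi =
    fourier (fun x => a * u x + v x) xi}.
Proof.
move=> [uf hu] [vf hv]; have lf := is_fourier_linear a uf vf.
split; first exact: sobolev_of_fourier lf (in_hsD (in_hsZ a hu) hv).
exact: (fourier_ae lf).2.
Qed.

End FourierLinear.

(** * The sine integral *)

Section SineIntegral.
Context {R : realType}.
Local Notation leb := (@lebesgue_measure R).
Implicit Types (x y a b c : R).

Lemma le_of_derive (f df : R -> R) a b : a <= b ->
  {within `[a, b], continuous f} ->
  (forall x, a < x < b -> is_derive x 1 f (df x)) ->
  (forall x, a < x < b -> 0 <= df x) -> f a <= f b.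
Proof.
rewrite le_eqVlt => /predU1P[->//|ab] cf Df df0.
have [x xab fE] : exists2 x, x \in `]a, b[ & f b - f a = df x * (b - a).
  by apply: MVT => // x; rewrite in_itv; exact: Df.
by rewrite -subr_ge0 fE mulr_ge0 ?subr_ge0 ?(ltW ab)// df0.
Qed.

Definition sinc x : R := if x == 0 then 1 else sin x / x.

Lemma sincE x : x * sinc x = sin x.
Proof.
rewrite /sinc; case: eqVneq => [->|x0]; first by rewrite mul0r sin0.
by rewrite mulrC divfK.
Qed.

Lemma sincN x : sinc (- x) = sinc x.
Proof. by rewrite /sinc oppr_eq0 sinN invrN mulrNN. Qed.

Lemma sinc_mvt x : 0 < x -> exists2 y, 0 < y < x & sinc x = cos y.
Proof.
move=> x0; have [y yx sE] : exists2 y, y \in `]0, x[ & sin x - sin 0 = cos y * (x - 0).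
  apply: MVT => //.
  by apply: continuous_subspaceT => z; exact: continuous_sin.
exists y; first by move: yx; rewrite in_itv.
by move: sE; rewrite sin0 !subr0 /sinc (gt_eqF x0) => ->; rewrite mulfK// gt_eqF.
Qed.

Lemma sinc_le1 x : `|sinc x| <= 1.
Proof.
wlog x0 : x / 0 <= x => [H|].
  by have [/H//|/ltW x0] := leP 0 x; rewrite -sincN; apply: H; rewrite oppr_ge0.
move: x0; rewrite le_eqVlt => /predU1P[<-|x0]; first by rewrite /sinc eqxx normr1.
by have [y _ ->] := sinc_mvt x0; exact: cos_max.
Qed.

Lemma cos_le_sinc x : 0 <= x <= pi / 2 -> cos x <= sinc x.
Proof.
move=> /andP[]; rewrite le_eqVlt => /predU1P[<- _|x0 xpi].
  by rewrite /sinc eqxx cos_le1.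
have [y /andP[y0 yx] ->] := sinc_mvt x0.
have xp : x <= pi by apply: le_trans xpi _; have := @pi_ge0 R; lra.
apply: ltW; rewrite ltr_cos// in_itv/=; apply/andP; split; lra.
Qed.

Lemma continuous_sinc : continuous sinc.
Proof.
move=> x; have [->|x0] := eqVneq x 0; last first.
  rewrite /continuous_at /sinc (negbTE x0).
  apply: (@cvg_trans _ (sin y / y @[y --> x])).
    apply: near_eq_cvg; near=> y.
    have /negbTE -> // : y != 0.
    by near: y; have := open_nbhs_nbhs (conj (@open_neq R 0) x0).
  apply: (@cvgM R R (nbhs x) _ sin (fun y => y^-1)).
    exact: continuous_sin.
  by apply: cvgV => //; exact: cvg_id.
rewrite /continuous_at {2}/sinc eqxx.
apply/cvgrPdist_le => e e0.
have cos1 : cos y @[y --> (0 : R)] --> (1 : R) by rewrite -[X in _ --> X]cos0; exact: continuous_cos.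
near=> y.
have [->|y0] := eqVneq y 0; first by rewrite /sinc eqxx subrr normr0 ltW.
have H : `|1 - cos y| <= e by near: y; move/cvgrPdist_le : cos1; apply.
apply: le_trans H.
have ypi : `|y| <= pi / 2.
  near: y; have := @nbhs0_le R R (pi / 2); apply.
  by rewrite divr_gt0// pi_gt0.
have cs : cos y <= sinc y.
  rewrite -cos_norm; have -> : sinc y = sinc `|y|.
    by case: (ger0P y) => // _; rewrite sincN.
  by apply: cos_le_sinc; rewrite normr_ge0.
have s1 : sinc y <= 1 by apply: le_trans (ler_norm _) (sinc_le1 _).
rewrite !ger0_norm ?subr_ge0 ?cos_le1//; lra.
Unshelve. all: by end_near. Qed.

Lemma integrable_sinc a b : leb.-integrable `[a, b] (EFin \o sinc).
Proof.
apply: continuous_compact_integrable; first exact: segment_compact.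
by apply: continuous_subspaceT; exact: continuous_sinc.
Qed.

Definition Si y : R := Rintegral leb `[0, y] sinc.

Lemma is_derive_Si y : 0 < y -> is_derive y 1 Si (sinc y).
Proof.
move=> y0; have yy : y < y + 1 by rewrite ltrDl.
have [D1 D2] := @continuous_FTC1 R sinc (BLeft 0) y (y + 1) yy
  (integrable_sinc _ _) y0 (@continuous_sinc y).
by split; [exact: D1|rewrite -derive1E; exact: D2].
Qed.

Lemma continuous_Si y : 0 <= y -> {within `[0, y], continuous Si}.
Proof. by move=> y0; exact: parameterized_integral_continuous (integrable_sinc _ _). Qed.

Lemma Si0 : Si 0 = 0.
Proof. by rewrite /Si set_itv1 Rintegral_set1. Qed.

Lemma continuous_pos_of_derive (f df : R -> R) a b : 0 < a ->
  (forall x, 0 < x -> is_derive x 1 f (df x)) -> {within `[a, b], continuous f}.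
Proof.
move=> a0 Df; apply: continuous_in_subspaceT => x.
rewrite inE/= in_itv/= => /andP[ax _].
have [Dx _] := Df x (lt_le_trans a0 ax).
by apply: differentiable_continuous; apply/derivable1_diffP.
Qed.

(** The primitive of the nonnegative function [(1 - cos x) / x^2], obtained
    from [Si] by one integration by parts. *)
Definition Si_mono y : R := Si y - (1 - cos y) / y.

Lemma is_derive_Si_mono y : 0 < y ->
  is_derive y 1 Si_mono ((1 - cos y) / y ^+ 2).
Proof.
move=> y0; have yn0 : y != 0 by rewrite gt_eqF.
have D1 := is_derive_Si y0.
have D2 := @is_deriveB R R^o R^o (cst 1) cos y 1 _ _ (is_derive_cst _ _ _)
  (is_derive_cos y).
have D3 := @is_deriveV R id y 1 1 yn0 (is_derive_id _ _).
have D4 := @is_deriveM R R^o _ _ _ _ _ _ D2 D3.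
have D5 := @is_deriveB R R^o R^o _ _ _ _ _ _ D1 D4.
apply: (is_derive_eq D5).
have scaleE (a b : R) : a *: (b : R^o) = a * b by [].
rewrite !scaleE /sinc (negbTE yn0) !fctE; field.
by [].
Qed.

Lemma Si_mono_le a b : 0 < a -> a <= b -> Si_mono a <= Si_mono b.
Proof.
move=> a0 ab; apply: (@le_of_derive Si_mono (fun y => (1 - cos y) / y ^+ 2)) => //.
- exact: continuous_pos_of_derive is_derive_Si_mono.
- by move=> x /andP[ax _]; apply: is_derive_Si_mono; exact: lt_trans ax.
- by move=> x _; rewrite divr_ge0 ?sqr_ge0// subr_ge0 cos_le1.
Qed.

(** [Si_mono y + 2 / y] has derivative [- (1 + cos y) / y ^+ 2]. *)
Lemma Si_mono_ge a b : 0 < a -> a <= b -> Si_mono b + 2 / b <= Si_mono a + 2 / a.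
Proof.
move=> a0 ab.
pose f y := - Si_mono y - 2 * y^-1.
pose df y := - ((1 - cos y) / y ^+ 2) - 2 * - y ^- 2.
have Df y : 0 < y -> is_derive y 1 f (df y).
  move=> y0; have yn0 : y != 0 by rewrite gt_eqF.
  have D1 := @is_deriveN R R^o R^o _ _ _ _ (is_derive_Si_mono y0).
  have D2 := @is_deriveV R id y 1 1 yn0 (is_derive_id _ _).
  have D3 := @is_deriveZ R R^o R^o _ 2 _ _ _ D2.
  have D4 := @is_deriveB R R^o R^o _ _ _ _ _ _ D1 D3.
  apply: (is_derive_eq D4).
  have scaleE (c d : R) : c *: (d : R^o) = c * d by [].
  by rewrite !scaleE mulr1.
suff : f a <= f b by rewrite /f; lra.
apply: (@le_of_derive f df) => //.
- exact: continuous_pos_of_derive Df.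
- by move=> x /andP[ax _]; apply: Df; exact: lt_trans ax.
- move=> x _; have -> : df x = (1 + cos x) / x ^+ 2 by rewrite /df; ring.
  by rewrite divr_ge0 ?sqr_ge0//; have := cos_geN1 x; lra.
Qed.

Lemma within_continuousB (f g : R -> R) a b :
  {within `[a, b], continuous f} -> {within `[a, b], continuous g} ->
  {within `[a, b], continuous (fun x => f x - g x)}.
Proof. by move=> cf cg x; apply: (@cvgB _ R^o); [exact: cf|exact: cg]. Qed.

Lemma Si_le y : 0 <= y -> `|Si y| <= y.
Proof.
move=> y0; rewrite ler_norml; apply/andP; split.
- suff : Si 0 - (- 0) <= Si y - (- y) by rewrite Si0; lra.
  apply: (@le_of_derive (fun x => Si x - - x) (fun x => sinc x - - 1)) => //.
  + apply: within_continuousB; first exact: continuous_Si.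
    by apply: continuous_subspaceT => x; apply: (@cvgN _ R^o); exact: cvg_id.
  + move=> x /andP[x0 _].
    exact: (@is_deriveB R R^o R^o _ _ _ _ _ _ (is_derive_Si x0)
      (@is_deriveN R R^o R^o _ _ _ _ (is_derive_id _ _))).
  + by move=> x _; have := sinc_le1 x; rewrite ler_norml => /andP[+ _]; lra.
- suff : 0 - Si 0 <= y - Si y by rewrite Si0; lra.
  apply: (@le_of_derive (fun x => x - Si x) (fun x => 1 - sinc x)) => //.
  + apply: within_continuousB; last exact: continuous_Si.
    by apply: continuous_subspaceT => x; exact: cvg_id.
  + move=> x /andP[x0 _].
    exact: (@is_deriveB R R^o R^o _ _ _ _ _ _ (is_derive_id _ _)
      (is_derive_Si x0)).
  + by move=> x _; have := sinc_le1 x; rewrite ler_norml => /andP[_]; lra.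
Qed.

(** On [[0, pi / 2]] the integrand [sinc] dominates [cos], whose integral is 1. *)
Lemma Si_pihalf_ge1 : 1 <= Si (pi / 2).
Proof.
have p0 : 0 <= pi / 2 :> R by rewrite divr_ge0// pi_ge0.
suff : Si 0 - sin 0 <= Si (pi / 2) - sin (pi / 2).
  by rewrite Si0 sin0 sin_pihalf; lra.
apply: (@le_of_derive (fun x => Si x - sin x) (fun x => sinc x - cos x)) => //.
- apply: within_continuousB; first exact: continuous_Si.
  by apply: continuous_subspaceT; exact: continuous_sin.
- move=> x /andP[x0 _].
  exact: (@is_deriveB R R^o R^o _ _ _ _ _ _ (is_derive_Si x0) (is_derive_sin x)).
- move=> x /andP[x0 xp]; rewrite subr_ge0 cos_le_sinc//.
  by rewrite !ltW.
Qed.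

Lemma pihalf_gt1 : 1 < pi / 2 :> R.
Proof.
rewrite lt_neqAle pihalf_ge1 andbT; apply/eqP => e.
by have := @cos1_gt0 R; rewrite e cos_pihalf ltxx.
Qed.

(** [Si] has a limit [c] at infinity. The value [pi / 2] of [c] is not computed:
    [c] is positive, which is enough, because [Si_mono] is nondecreasing and
    [Si_mono (pi / 2) >= 1 - 2 / pi]. *)
Lemma Si_limit : exists2 c : R, 0 < c &
  forall y, 0 < y -> `|c - Si y| <= 4 / y.
Proof.
pose S := [set Si_mono y | y in [set y | 0 < y]].
have S0 : S !=set0 by exists (Si_mono 1); exists 1 => //=.
have SE a : 0 < a -> ubound S (Si_mono a + 2 / a).
  move=> a0 _ [y /= y0 <-]; have [ay|/ltW ya] := leP a y.
    apply: le_trans (Si_mono_ge a0 ay); rewrite lerDl divr_ge0//; exact: ltW.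
  apply: le_trans (Si_mono_le y0 ya) _; rewrite lerDl divr_ge0//; exact: ltW.
have hS : has_sup S by split => //; exists (Si_mono 1 + 2 / 1); exact: SE.
have lec y : 0 < y -> Si_mono y <= sup S.
  by move=> y0; apply: sup_upper_bound => //; exists y.
have cle y : 0 < y -> sup S <= Si_mono y + 2 / y.
  by move=> y0; apply: ge_sup => //; exact: SE.
exists (sup S).
  have p0 : 0 < pi / 2 :> R by rewrite divr_gt0// pi_gt0.
  apply: lt_le_trans (lec _ p0).
  rewrite /Si_mono cos_pihalf subr0 div1r subr_gt0.
  by apply: lt_le_trans Si_pihalf_ge1; rewrite invf_lt1// pihalf_gt1.
move=> y y0; have := lec y y0; have := cle y y0; rewrite /Si_mono => h1 h2.
have yV : 0 < y^-1 by rewrite invr_gt0.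
have : 0 <= (1 - cos y) / y <= 2 / y.
  rewrite divr_ge0 ?subr_ge0 ?cos_le1 ?(ltW y0)//= ler_pM2r//.
  by have := cos_geN1 y; lra.
move=> /andP[h3 h4]; rewrite ler_norml; apply/andP; split; lra.
Qed.

(** One bound for small and large [y], in terms of a function that is integrable
    over the line. *)
Lemma Si_error : exists2 c : R, 0 < c & exists2 B : R, 0 < B &
  forall y, 0 < y -> (c - Si y) ^+ 2 <= B / (1 + y ^+ 2).
Proof.
have [c c0 Hc] := Si_limit; exists c => //.
exists (2 * (c + 1) ^+ 2 + 32); first by nra.
move=> y y0; have y20 : 0 < 1 + y ^+ 2 by rewrite ltr_pwDl ?sqr_ge0.
rewrite ler_pdivlMr//.
have [y1|y1] := leP y 1.
  have := Si_le (ltW y0); rewrite ler_norml => /andP[h1 h2].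
  have h : (c - Si y) ^+ 2 <= (c + 1) ^+ 2.
    by rewrite -ler_sqrt ?sqr_ge0// !sqrtr_sqr ler_norml !ger0_norm; lra.
  have : 1 + y ^+ 2 <= 2 by nra.
  move: h; set A := (_ - _) ^+ 2; have : 0 <= A by exact: sqr_ge0.
  set D := (c + 1) ^+ 2; nra.
have h : (c - Si y) ^+ 2 * y ^+ 2 <= 16.
  rewrite -exprMn -real_normK ?num_real// normrM (gtr0_norm y0).
  have -> : 16 = 4 ^+ 2 :> R by ring.
  rewrite lerXn2r ?nnegrE ?mulr_ge0 ?(ltW y0)//.
  by rewrite -ler_pdivlMr// Hc.
have : 0 <= (c - Si y) ^+ 2 by exact: sqr_ge0.
have : 1 <= y ^+ 2 by nra.
move: h; set A := (_ - _) ^+ 2; set D := (c + 1) ^+ 2 => h.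
have : 0 <= D by exact: sqr_ge0.
nra.
Qed.

End SineIntegral.

(** * Truncated Dirichlet integrals *)

Section TestFunctions.
Context {R : realType}.
Local Notation leb := (@lebesgue_measure R).
Implicit Types (x y a b c r : R) (k : R).

(** The integrand is [sin (c * x) / x], extended by continuity to [x = 0]. *)
Definition dirichlet k c : R := Rintegral leb `[0, k] (fun x => c * sinc (c * x)).

Lemma continuous_sincM c : continuous (fun x : R => c * sinc (c * x)).
Proof.
move=> x; apply: (@cvgM R R (nbhs x) _ (fun=> c) (fun y => sinc (c * y))).
  exact: cvg_cst.
apply: (@continuous_comp _ _ _ (fun y => c * y) sinc); last exact: continuous_sinc.
exact: mulrl_continuous.
Qed.

Lemma continuous_integrable (f : R -> R) a b : continuous f ->
  leb.-integrable `[a, b] (EFin \o f).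
Proof.
move=> cf; apply: continuous_compact_integrable; first exact: segment_compact.
exact: continuous_subspaceT.
Qed.

Lemma is_derive_SiM c x : 0 < c -> 0 < x ->
  is_derive x 1 (fun y => Si (c * y)) (c * sinc (c * x)).
Proof.
move=> c0 x0.
have D1 := @is_derive_Si R _ (mulr_gt0 c0 x0).
have D2 := @is_deriveZ R R^o R^o _ c _ _ _ (is_derive_id x (1 : R)).
have D3 := @is_derive1_comp _ _ _ _ _ _ D1 D2.
apply: (is_derive_eq D3).
have scaleE (d e : R) : d *: (e : R^o) = d * e by [].
by rewrite !scaleE; ring.
Qed.

Lemma dirichlet_Si k c : 0 < k -> 0 < c -> dirichlet k c = Si (c * k).
Proof.
move=> k0 c0; rewrite /dirichlet /Rintegral.
rewrite (@continuous_FTC2 _ _ (fun y => Si (c * y)))//.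
- by rewrite mulr0 Si0 sube0.
- by apply: continuous_subspaceT; exact: continuous_sincM.
- split.
  + by move=> x; rewrite in_itv/= => /andP[x0 _]; have [] := is_derive_SiM c0 x0.
  + rewrite mulr0 Si0; apply/cvgrPdist_le => e e0; near=> x.
    have x0 : 0 < x by near: x; exact: nbhs_right_gt.
    have cx0 : 0 < c * x by rewrite mulr_gt0.
    rewrite sub0r normrN (le_trans (Si_le (ltW cx0)))//.
    rewrite mulrC -ler_pdivlMr//.
    by near: x; apply: nbhs_right_le; rewrite divr_gt0.
  + have cF : {for k, continuous (fun y => Si (c * y))}.
      apply: differentiable_continuous; apply/derivable1_diffP.
      by have [] := is_derive_SiM c0 k0.
    by apply: cvg_at_left_filter; exact: cF.
- move=> x; rewrite in_itv/= => /andP[x0 _].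
  by rewrite derive1E; have [_ ->] := is_derive_SiM c0 x0.
Unshelve. all: by end_near. Qed.

Lemma dirichletN k c : dirichlet k (- c) = - dirichlet k c.
Proof.
rewrite /dirichlet -[RHS]mulN1r -RintegralZl//; last first.
  exact: continuous_integrable (@continuous_sincM c).
by apply: eq_Rintegral => x _; rewrite !mulNr sincN mul1r.
Qed.

Lemma dirichlet0 k : dirichlet k 0 = 0.
Proof.
by rewrite /dirichlet; under eq_Rintegral do rewrite mul0r; rewrite Rintegral_cst// mul0r.
Qed.

Lemma Rintegral_symmetric (f : R -> R) k : 0 <= k -> continuous f ->
  Rintegral leb `[- k, k] f = Rintegral leb `[0, k] (fun x => f x + f (- x)).
Proof.
move=> k0 cf; have cfN : continuous (f \o -%R).
  by move=> x; apply: (@continuous_comp _ _ _ -%R f); [exact: oppr_continuous|exact: cf].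
rewrite RintegralD//; [|exact: continuous_integrable..].
have -> : Rintegral leb `[0, k] (fun x => f (- x)) = Rintegral leb `[- k, 0] f.
  rewrite /Rintegral; congr fine; rewrite -{2}oppr0 integration_by_substitution_oppr//.
  exact: continuous_subspaceT.
rewrite addrC -(@Rintegral_itv_obnd_cbnd _ 0); last first.
  by apply: integrableS (continuous_integrable 0 k cf) => //; exact: subset_itv_oc_cc.
rewrite -(@Rintegral_itvB _ f (BLeft (- k)) (BRight k) 0).
- by rewrite addrC subrK.
- exact: continuous_integrable.
- by rewrite bnd_simp lerNl oppr0.
- by rewrite bnd_simp.
Qed.

(** By the primitive [atan (k * y) / k]. *)
Lemma integral_oneDsqrV k : 0 < k ->
  (\int[leb]_x ((1 + (k * x) ^+ 2)^-1)%:E = (pi / k)%:E)%E.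
Proof.
move=> k0; pose f x : R := (1 + (k * x) ^+ 2)^-1.
have p x : 0 < 1 + (k * x) ^+ 2 by rewrite ltr_pwDl ?sqr_ge0.
have cf : continuous f.
  move=> x; apply: (@continuous_comp _ _ _ (fun y => k * y) (fun y : R => (1 + y ^+ 2)^-1)).
    exact: mulrl_continuous.
  exact: continuous_oneDsqrV.
have Df x : is_derive x 1 (fun y => atan (k * y) / k) (f x).
  have D1 := is_derive1_atan (k * x).
  have D2 := @is_deriveZ R R^o R^o _ k _ _ _ (is_derive_id x (1 : R)).
  have D3 := @is_derive1_comp _ _ _ _ _ _ D1 D2.
  have D4 := @is_deriveZ R R^o R^o _ k^-1 _ _ _ D3.
  have -> : (fun y => atan (k * y) / k) = k^-1 \*: (atan \o ( *:%R k)).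
    by apply/funext => y /=; rewrite mulrC.
  apply: (is_derive_eq D4).
  have scaleE (d e : R) : d *: (e : R^o) = d * e by [].
  rewrite !scaleE /f; field.
  by rewrite !gt_eqF.
rewrite ge0_symfun_integralT//; last 2 first.
- by move=> x; rewrite invr_ge0 ltW.
- by move=> x /=; rewrite mulrN sqrrN.
have -> : [set x : R | 0 <= x] = `[0, +oo[%classic by rewrite set_itvcy.
rewrite (@ge0_continuous_FTC2y _ f (fun y => atan (k * y) / k) 0 (pi / 2 / k)).
- rewrite mulr0 atan0 mul0r sube0 -EFinM; congr EFin; field.
  by rewrite gt_eqF.
- by move=> x _; rewrite invr_ge0 ltW.
- exact: continuous_subspaceT.
- apply: cvgMr_tmp.
  apply: (@cvg_comp _ _ _ (fun x => k * x) atan _ (pinfty_nbhs R)); last exact: cvgy_atan.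
  by apply: gt0_cvgMry => //; exact: cvg_id.
- by move=> x _; have [] := Df x.
- have cF : {for 0, continuous (fun y => atan (k * y) / k)}.
    by apply: differentiable_continuous; apply/derivable1_diffP; have [] := Df 0.
  by apply: cvg_at_right_filter; exact: cF.
- by move=> x _; rewrite derive1E; have [_ ->] := Df x.
Qed.

End TestFunctions.

(** * Modulated cardinal sines *)

Section BandLimited.
Context {R : realType}.
Local Notation leb := (@lebesgue_measure R).
Local Notation cmeasR f := (@cmeasurable R _ (measurableTypeR R) f).
Implicit Types (x y a b c r mu xi : R) (k : nat).

(** The function with transform proportional to the indicator of
    [[mu - r, mu + r]]. *)
Definition modulated_sinc mu r x : R[i] := cis (mu * x) * (r * sinc (r * x))%:C.

(** The formula [2 cos (a x) sin (r x) = sin ((r + a) x) + sin ((r - a) x)],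
    divided by [x]. *)
Lemma sincM_sum a r x : 2 * (cos (a * x) * (r * sinc (r * x))) =
  (r + a) * sinc ((r + a) * x) + (r - a) * sinc ((r - a) * x).
Proof.
have [->|x0] := eqVneq x 0.
  by rewrite !mulr0 /sinc eqxx cos0; ring.
apply: (mulfI x0); rewrite mulrDr.
have e c : x * (c * sinc (c * x)) = sin (c * x).
  by rewrite mulrA -sincE (mulrC x).
rewrite !e mulrCA [x * _]mulrCA e !mulrDl mulNr sinB sinD; ring.
Qed.

Lemma cmeasurable_modulated_sinc mu r : cmeasR (modulated_sinc mu r).
Proof.
apply: cmeasurableM.
  by apply: (cmeasurable_comp (@cmeasurable_cis R)).
apply: cmeasurable_real; apply: continuous_measurable_fun.
exact: continuous_sincM.
Qed.

Lemma in_L2_modulated_sinc mu r : in_L2 (modulated_sinc mu r).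
Proof.
have mu_ := cmeasurable_modulated_sinc mu r.
split => //; apply/normL2_lty.
apply: (@le_lt_trans _ _
    (\int[leb]_x ((1 + r ^+ 2)%:E * ((1 + (1 * x) ^+ 2)^-1)%:E))%E).
  apply: ge0_le_integral => //.
  - by move=> x _; rewrite lee_fin sqr_ge0.
  - exact/measurable_EFinP/measurable_funX/measurable_cmod.
  - apply: measurable_funeM; apply/measurable_EFinP.
    apply: continuous_measurable_fun => x.
    apply: (@continuous_comp _ _ _ (fun y => 1 * y) (fun y : R => (1 + y ^+ 2)^-1)).
      exact: mulrl_continuous.
    exact: continuous_oneDsqrV.
  - move=> x _; rewrite -EFinM lee_fin mul1r.
    rewrite cmodM cmod_cis mul1r cmod_real real_normK ?num_real//.
    rewrite ler_pdivlMr ?ltr_pwDl ?sqr_ge0//.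
    have sq1 y : `|y| <= 1 -> y ^+ 2 <= 1.
      by move=> y1; rewrite -real_normK ?num_real// expr_le1.
    have -> : (r * sinc (r * x)) ^+ 2 * (1 + x ^+ 2) =
        r ^+ 2 * sinc (r * x) ^+ 2 + sin (r * x) ^+ 2.
      by rewrite -sincE; ring.
    by rewrite [leRHS]addrC lerD ?sq1 ?sin_max// ler_piMr ?sqr_ge0// sq1// sinc_le1.
rewrite ge0_integralZl ?lee_fin//.
- by rewrite integral_oneDsqrV// -EFinM ltry.
- apply/measurable_EFinP; apply: continuous_measurable_fun => x.
  apply: (@continuous_comp _ _ _ (fun y => 1 * y) (fun y : R => (1 + y ^+ 2)^-1)).
    exact: mulrl_continuous.
  exact: continuous_oneDsqrV.
- by move=> x _; rewrite lee_fin invr_ge0 addr_ge0 ?sqr_ge0.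
- by rewrite addr_ge0 ?sqr_ge0.
Qed.

Lemma continuous_cos_sinc a r :
  continuous (fun x : R => cos (a * x) * (r * sinc (r * x))).
Proof.
move=> x; apply: (@cvgM R R (nbhs x) _ (fun x => cos (a * x)) (fun y => r * sinc (r * y))).
  apply: (@continuous_comp _ _ _ (fun y => a * y) cos); last exact: continuous_cos.
  exact: mulrl_continuous.
exact: continuous_sincM.
Qed.

Lemma continuous_sin_sinc a r :
  continuous (fun x : R => sin (a * x) * (r * sinc (r * x))).
Proof.
move=> x; apply: (@cvgM R R (nbhs x) _ (fun x => sin (a * x)) (fun y => r * sinc (r * y))).
  apply: (@continuous_comp _ _ _ (fun y => a * y) sin); last exact: continuous_sin.
  exact: mulrl_continuous.
exact: continuous_sincM.
Qed.

(** The imaginary part of the integrand is odd and contributes nothing. *)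
Lemma truncated_transform mu r k xi :
  fourierL1 (truncate k (modulated_sinc mu r)) xi =
  ((Num.sqrt (2 * pi))^-1)%:C *
  (dirichlet k%:R (r + (mu - xi)) + dirichlet k%:R (r - (mu - xi)))%:C.
Proof.
rewrite /fourierL1; congr (_ * _); set a := mu - xi.
have eF x : truncate k (modulated_sinc mu r) x * cis (- (xi * x)) =
    (\1_(`[- k%:R, k%:R]%classic : set R) x *
      (cos (a * x) * (r * sinc (r * x)))) +i*
    (\1_(`[- k%:R, k%:R]%classic : set R) x *
      (sin (a * x) * (r * sinc (r * x)))).
  rewrite truncateE /modulated_sinc /a mulrBl cosB sinB.
  by rewrite /cis cosN sinN; apply: complex_ext; rewrite !(ReM, ImM)/=; ring.
have k0 : 0 <= k%:R :> R by [].
have restr (f : R -> R) :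
    Rintegral leb setT (fun x => \1_(`[- k%:R, k%:R]%classic : set R) x * f x) =
    Rintegral leb `[- k%:R, k%:R] f.
  rewrite [RHS]Rintegral_mkcond; apply: eq_Rintegral => x _.
  by rewrite patchE indicE; case: ifP; rewrite ?mul1r ?mul0r.
rewrite (funext eF) /cintegral; apply: complex_ext => /=.
  rewrite restr Rintegral_symmetric//; last exact: continuous_cos_sinc.
  rewrite /dirichlet -RintegralD//;
    [|exact: continuous_integrable (@continuous_sincM _ _)..].
  apply: eq_Rintegral => x _; rewrite -sincM_sum !mulrN cosN sincN; ring.
rewrite restr Rintegral_symmetric//; last exact: continuous_sin_sinc.
rewrite (@eq_Rintegral _ _ _ _ _ (fun=> 0)) ?Rintegral_cst ?mul0r//.
by move=> x _; rewrite !mulrN sinN sincN; ring.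
Qed.

End BandLimited.

(** * Elements of the Sobolev space with an indicator as transform *)

Section TestFunction.
Context {R : realType}.
Local Notation leb := (@lebesgue_measure R).
Local Notation cmeasR f := (@cmeasurable R _ (measurableTypeR R) f).
Implicit Types (x y a b c r mu xi : R).

Definition indicator a b x : R[i] := (\1_(`[a, b]%classic : set R) x)%:C.

Lemma cmeasurable_indicator a b : cmeasR (indicator a b).
Proof. by apply: cmeasurable_real; exact: measurable_indic. Qed.

Lemma in_hs_indicator s a b : in_hs s (indicator a b).
Proof.
have mI := cmeasurable_weight s (cmeasurable_indicator a b).
split => //; apply/normL2_lty.
pose f x : R := japanese x `^ s * japanese x `^ s.
have -> : energy (sobolev_weight s (indicator a b)) =
    (\int[leb]_(x in `[a, b]) (f x)%:E)%E.
  rewrite [RHS]integral_mkcond; apply: eq_integral => x _.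
  rewrite cmodM !cmod_real patchE indicE; case: ifP => _.
    by rewrite normr1 mulr1 ger0_norm ?powR_ge0// expr2.
  by rewrite normr0 mulr0 expr0n.
have /integrableP[_] : leb.-integrable `[a, b] (EFin \o f).
  apply: continuous_integrable => x.
  by apply: (@cvgM R R (nbhs x) _ (fun x => japanese x `^ s) (fun x => japanese x `^ s));
    exact: continuous_japanese_powR.
by under eq_integral do rewrite /= ger0_norm ?mulr_ge0 ?powR_ge0//.
Qed.

Lemma ae_neq (p : R) : {ae leb, forall x, x != p}.
Proof.
exists [set p]; split => //; first exact: lebesgue_measure_set1.
by move=> x /= /negP; rewrite negbK => /eqP.
Qed.

Section Limit.
Variables (c B : R).
Hypothesis B0 : 0 < B.
Hypothesis HcB : forall y, 0 < y -> (c - Si y) ^+ 2 <= B / (1 + y ^+ 2).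

Lemma dirichlet_error (k : R) d : 0 < k ->
  (c * Num.sg d - dirichlet k d) ^+ 2 <= B / (1 + (k * d) ^+ 2).
Proof.
move=> k0; have [d0|d0|<-] := ltgtP 0 d.
- by rewrite gtr0_sg// mulr1 dirichlet_Si// (mulrC d) HcB// mulr_gt0.
- have e0 : 0 < - d by rewrite oppr_gt0.
  have dE : dirichlet k d = - Si (- d * k).
    by rewrite -[d in LHS]opprK dirichletN dirichlet_Si.
  have -> : (k * d) ^+ 2 = (- d * k) ^+ 2 by ring.
  rewrite ltr0_sg// dE mulrN1 -opprD sqrrN.
  exact: HcB (mulr_gt0 e0 k0).
- by rewrite sgr0 dirichlet0 mulr0 subr0 mulr0 expr0n/= divr_ge0 ?ltW// ltr_pwDl.
Qed.

Let C0 : R := (Num.sqrt (2 * pi))^-1.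

(** The pointwise limit in [k] of [truncated_transform]: a truncated Dirichlet
    integral tends to [c] times the sign of its frequency. *)
Definition sign_sum mu r xi : R[i] :=
  (C0)%:C * (c * (Num.sg (r + (mu - xi)) + Num.sg (r - (mu - xi))))%:C.

Lemma measurable_bump (k : R) : measurable_fun setT
  (fun x : measurableTypeR R => ((1 + (k * x) ^+ 2)^-1)%:E).
Proof.
apply/measurable_EFinP; apply: continuous_measurable_fun => x.
apply: (@continuous_comp _ _ _ (fun y => k * y) (fun y : R => (1 + y ^+ 2)^-1)).
  exact: mulrl_continuous.
exact: continuous_oneDsqrV.
Qed.

(** The squared error is dominated by two functions of the shape
    [1 / (1 + (k * x) ^+ 2)] centred at the ends of the interval, each of
    integral [pi / k]. *)
Lemma sign_sum_error mu r (k : nat) : (0 < k)%N ->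
  cmeasR (fun xi => sign_sum mu r xi -
    fourierL1 (truncate k (modulated_sinc mu r)) xi) ->
  (energy (fun xi => sign_sum mu r xi -
    fourierL1 (truncate k (modulated_sinc mu r)) xi)%R <=
   (4 * C0 ^+ 2 * B * pi / k%:R)%:E)%E.
Proof.
move=> k0 mE; have k0R : 0 < k%:R :> R by rewrite ltr0n.
pose b x : \bar R := ((1 + (k%:R * x) ^+ 2)^-1)%:E.
have mb : measurable_fun setT (b : measurableTypeR R -> \bar R).
  exact: measurable_bump.
have b0 x : (0 <= b x)%E by rewrite lee_fin invr_ge0 addr_ge0 ?sqr_ge0.
have D0 : (0 <= (2 * C0 ^+ 2 * B)%:E)%E.
  by rewrite lee_fin mulr_ge0 ?(ltW B0)// mulr_ge0 ?sqr_ge0.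
have m1 : measurable_fun setT (fun xi : measurableTypeR R => b (r + mu - xi)).
  exact: (measurableT_comp mb (measurable_reflect _)).
have m2 : measurable_fun setT (fun xi : measurableTypeR R => b (xi - (mu - r))).
  have msh : measurable_fun setT
    (fun xi : measurableTypeR R => xi - (mu - r) : measurableTypeR R).
    by apply: measurable_funB.
  exact: (measurableT_comp mb msh).
apply: (@le_trans _ _ (\int[leb]_xi ((2 * C0 ^+ 2 * B)%:E *
    (b (r + mu - xi)%R + b (xi - (mu - r))%R)))%E).
  apply: ge0_le_integral => //.
  - by move=> x _; rewrite lee_fin sqr_ge0.
  - exact/measurable_EFinP/measurable_funX/measurable_cmod.
  - by apply: measurable_funeM; exact: emeasurable_funD.
  - move=> xi _; rewrite truncated_transform /sign_sum -/C0 -mulrBr -rmorphB.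
    rewrite cmodM !cmod_real exprMn !real_normK ?num_real//.
    rewrite /b -EFinD -EFinM lee_fin.
    have eB (X Y : R) : 2 * C0 ^+ 2 * B * (X + Y) = C0 ^+ 2 * (2 * (B * X + B * Y)).
      by ring.
    rewrite eB ler_wpM2l ?sqr_ge0//.
    have e1 := dirichlet_error (r + (mu - xi)) k0R.
    have e2 := dirichlet_error (r - (mu - xi)) k0R.
    have -> : r + mu - xi = r + (mu - xi) by ring.
    have -> : xi - (mu - r) = r - (mu - xi) by ring.
    move: e1 e2; set d1 := dirichlet _ _; set d2 := dirichlet _ _.
    set s1 := Num.sg _; set s2 := Num.sg _; set P := B / _; set Q := B / _.
    have -> : c * (s1 + s2) - (d1 + d2) = (c * s1 - d1) + (c * s2 - d2) by ring.
    set x1 := c * s1 - d1; set x2 := c * s2 - d2 => e1 e2.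
    have := sqr_ge0 (x1 - x2); nra.
rewrite ge0_integralZl//; last 2 first.
- exact: emeasurable_funD.
- by move=> x _; rewrite adde_ge0.
rewrite ge0_integralD// ge0_integral_reflect// ge0_integral_shift//.
rewrite integral_oneDsqrV// -EFinD -EFinM lee_fin.
by rewrite le_eqVlt; apply/orP; left; apply/eqP; ring.
Qed.

(** The two signs cancel outside the interval and add up inside; the ends form a
    null set. *)
Lemma sign_sum_indicator mu r : 0 < r ->
  {ae leb, forall xi, sign_sum mu r xi =
    (C0 * (2 * c))%:C * indicator (mu - r) (mu + r) xi}.
Proof.
move=> r0; have h1 := ae_neq (mu - r); have h2 := ae_neq (mu + r).
apply: (ae_imply2 _ h1 h2) => xi n1 n2.
rewrite /sign_sum /indicator indicE mem_setE in_itv/= -!rmorphM/= -mulrA.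
congr (_%:C); congr (_ * _).
have [lt1|gt1|e1] := ltgtP (mu - r) xi; last by rewrite e1 eqxx in n1.
  have [lt2|gt2|e2] := ltgtP xi (mu + r); last by rewrite e2 eqxx in n2.
    by rewrite !gtr0_sg ?mulr1//=; [ring|lra|lra].
  by rewrite ltr0_sg ?gtr0_sg ?mulr0//=; [ring|lra|lra].
by rewrite gtr0_sg ?ltr0_sg//=; [ring|lra|lra].
Qed.

Lemma is_fourier_modulated_sinc mu r : 0 < r ->
  is_fourier (modulated_sinc mu r)
    (fun xi => (C0 * (2 * c))%:C * indicator (mu - r) (mu + r) xi).
Proof.
move=> r0; set g := (fun xi => _ * indicator _ _ xi).
have hI : in_L2 (indicator (mu - r) (mu + r)).
  have := in_hs_indicator 0 (mu - r) (mu + r); rewrite /in_hs.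
  congr in_L2; apply/funext => x.
  by rewrite /sobolev_weight powRr0 mul1r.
have hg : in_L2 g by exact: in_L2Z.
have hu := in_L2_modulated_sinc mu r.
split => //.
have mF k : cmeasR (fourierL1 (truncate k (modulated_sinc mu r))).
  by apply/cmeasurable_fourierL1/cmeasurable_truncate; case: hu.
have mg : cmeasR g by case: hg.
pose W := 4 * C0 ^+ 2 * B * pi.
have W0 : 0 <= W by rewrite mulr_ge0 ?pi_ge0// mulr_ge0 ?(ltW B0)// mulr_ge0 ?sqr_ge0.
have ms : cmeasR (sign_sum mu r).
  apply: cmeasurableM; first exact: cmeasurable_cst.
  apply: cmeasurable_real; apply: measurable_funM; first exact: measurable_cst.
  have sgE : Num.sg = (fun x : R => \1_`]0, +oo[%classic x - \1_`]-oo, 0[%classic x).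
    apply/funext => x; rewrite !indicE !mem_setE !in_itv/= andbT.
    have [x0|x0|<-] := ltgtP 0 x.
    - by rewrite gtr0_sg//= mulr0n subr0.
    - by rewrite ltr0_sg//= mulr0n sub0r.
    - by rewrite sgr0/= mulr0n subr0.
  have msg : measurable_fun setT (Num.sg : R -> R).
    by rewrite sgE; apply: measurable_funB; exact: measurable_indic.
  apply: measurable_funD; apply: (measurableT_comp msg).
    by apply: measurable_funD => //; exact: measurable_funB.
  by apply: measurable_funB => //; exact: measurable_funB.
have bound k : (0 < k)%N ->
    (normL2 (fun xi => g xi - fourierL1 (truncate k (modulated_sinc mu r)) xi)%R
      <= (Num.sqrt (W / k%:R))%:E)%E.
  move=> k0.
  rewrite (@normL2_ae _ _ (fun xi => sign_sum mu r xi -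
    fourierL1 (truncate k (modulated_sinc mu r)) xi)); first last.
  - apply: ae_imply (sign_sum_indicator mu r0) => xi e.
    by rewrite e.
  - exact: cmeasurableB.
  - exact: cmeasurableB.
  apply: normL2_le; first exact: sqrtr_ge0.
  rewrite sqr_sqrtr ?divr_ge0//.
  by apply: sign_sum_error => //; exact: cmeasurableB.
have lim0 : (Num.sqrt (W / k%:R))%:E @[k --> \oo] --> 0%E.
  apply: cvg_EFin; first exact: nearW.
  apply/cvgrPdist_le => e e0; near=> k.
  have kpos : 0 < k%:R :> R by rewrite ltr0n; near: k; exact: nbhs_infty_gt.
  rewrite sub0r normrN ger0_norm ?sqrtr_ge0//=.
  have -> : e = Num.sqrt (e ^+ 2) by rewrite sqrtr_sqr ger0_norm// ltW.
  rewrite ler_wsqrtr//.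
  rewrite ler_pdivrMr// mulrC -ler_pdivrMr ?exprn_gt0//.
  by near: k; exact: nbhs_infty_ger.
apply: (squeeze_cvge _ (cvg_cst 0%E) lim0).
near=> k; rewrite normL2_ge0/= bound//.
by near: k; exact: nbhs_infty_gt.
Unshelve. all: by end_near. Qed.

End Limit.

Lemma sobolev_interval_transform s a b : a < b ->
  exists u, exists2 kappa : R[i], kappa != 0 &
  sobolev s u /\ {ae leb, forall xi, fourier u xi = kappa * indicator a b xi}.
Proof.
move=> ab; have [c c0 [B B0 HcB]] := @Si_error R.
pose mu := (a + b) / 2; pose r := (b - a) / 2.
have r0 : 0 < r by rewrite divr_gt0// subr_gt0.
have := is_fourier_modulated_sinc B0 HcB mu r0.
have -> : mu - r = a by rewrite /mu /r; field.
have -> : mu + r = b by rewrite /mu /r; field.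
set kappa := (_)%:C => uf; exists (modulated_sinc mu r), kappa.
  rewrite /kappa -cmod_eq0 cmod_real normr_eq0 !mulf_neq0 ?invr_neq0 ?(gt_eqF c0)//.
  by rewrite gt_eqF// sqrtr_gt0 mulr_gt0// pi_gt0.
have [_ H] := fourier_ae uf; split; last by apply: ae_imply H => xi.
by apply: (sobolev_of_fourier uf); apply: in_hsZ; exact: in_hs_indicator.
Qed.

(** When [b <= a] the indicator vanishes almost everywhere, as does the
    transform of [- u + u]. *)
Lemma sobolev_indicator_transform s a b : exists u, exists2 kappa : R[i], kappa != 0 &
  sobolev s u /\ {ae leb, forall xi, fourier u xi = kappa * indicator a b xi}.
Proof.
have [ab|ba] := ltP a b; first exact: sobolev_interval_transform.
have [u [k _ [hu _]]] := sobolev_interval_transform s (@ltr01 R).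
have [hz zE] := sobolev_linear (-1) hu hu.
exists (fun x => -1 * u x + u x), 1; first exact: oner_neq0.
split => //; apply: (ae_imply2 _ zE (ae_neq a)) => xi <- xa.
rewrite mulN1r addNr mul1r /indicator indicE mem_setE in_itv/=.
suff -> : (a <= xi <= b) = false by [].
apply/negbTE/negP => /andP[h1 h2]; move: xa; rewrite eq_le h1 andbT.
by rewrite (le_trans h2 ba).
Qed.

End TestFunction.

(** * Functions with zero integral on rectangles *)

Section NullIntegrals.
Local Open Scope ereal_scope.

(** The measurable sets on which the integral vanishes form a Dynkin system. *)
Lemma null_integral_dynkin d (T : measurableType d) (R : realType)
    (mu : {measure set T -> \bar R}) (G : set (set T)) (f : T -> \bar R) :
  @measurable _ T = <<s G >> -> setI_closed G -> mu.-integrable setT f ->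
  \int[mu]_x f x = 0 -> (forall A, G A -> \int[mu]_(x in A) f x = 0) ->
  forall A, measurable A -> \int[mu]_(x in A) f x = 0.
Proof.
move=> GE GI fi fT fG A mA.
apply: (@dynkin_induction _ T G (fun A => \int[mu]_(x in A) f x = 0)) => //.
- move=> S mS fS; have := fT; rewrite -(setUv S) integral_setU//.
  + by rewrite fS add0e.
  + exact: measurableC.
  + by rewrite setUv; exact: measurable_int fi.
  + exact/disj_setPCl.
- move=> F mF tF F0; rewrite integral_bigcup//.
    by apply: eseries0 => i _ _; rewrite F0.
  by apply: integrableS fi => //; exact: bigcupT_measurable.
- by rewrite -GE.
Qed.

Context {R : realType}.
Local Notation leb := (@lebesgue_measure R).
Local Notation leb2 := (leb \x leb).
Local Notation RR := (measurableTypeR R * measurableTypeR R)%type.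

(** The vanishing of [f] off [[- K, K]] gives the integral over the whole line,
    which a Dynkin system must contain. *)
Lemma null_on_intervals (f : measurableTypeR R -> \bar R) (K : R) :
  leb.-integrable setT f -> (forall x, ~~ (- K <= x <= K)%R -> f x = 0) ->
  (forall a b : R, \int[leb]_(x in `[a, b]) f x = 0) ->
  forall A, measurable A -> \int[leb]_(x in A) f x = 0.
Proof.
move=> fi fK fI A mA.
apply: (@null_integral_dynkin _ (measurableTypeR R) R leb (@ocitv R) f) => //.
- exact: ocitvI.
- rewrite -[RHS](fI (- K)%R K) [RHS]integral_mkcond; apply: eq_integral => x _.
  rewrite patchE mem_setE in_itv/=; case: ifPn => // /fK ->.
  by [].
- move=> _ [[a b] _ <-]; rewrite integral_itv_obnd_cbnd ?fI//.
  exact: measurable_funS (measurable_int _ fi).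
Qed.

Lemma rectangle_integral1 (f : RR -> \bar R) (A B : set (measurableTypeR R)) :
  measurable A -> measurable B -> leb2.-integrable setT f ->
  leb.-integrable setT (fun x => \int[leb]_(y in B) f (x, y)) /\
  \int[leb2]_(z in A `*` B) f z = \int[leb]_(x in A) \int[leb]_(y in B) f (x, y).
Proof.
move=> mA mB fi.
have restr (C : set RR) : measurable C -> leb2.-integrable setT (f \_ C).
  by move=> mC; apply/(integrable_mkcond _ mC); exact: integrableS fi.
split.
  have := @integrable_fubini_F _ _ _ _ R leb leb _ (restr _ (measurableX measurableT mB)).
  apply: eq_integrable => // x _; rewrite [RHS]integral_mkcond.
  apply: eq_integral => y _; rewrite !patchE.
  by rewrite in_setX in_setT.
rewrite integral_mkcond -(integral12_prod_meas1 (restr _ (measurableX mA mB))).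
rewrite [RHS]integral_mkcond; apply: eq_integral => x _.
rewrite patchE; case: ifPn => xA.
  rewrite [RHS]integral_mkcond; apply: eq_integral => y _.
  by rewrite !patchE in_setX xA.
apply: integral0_eq => y _; rewrite patchE in_setX.
by rewrite (negbTE xA).
Qed.

Lemma integrable_section2 (f : RR -> \bar R) : leb2.-integrable setT f ->
  leb.-integrable setT (fun y => \int[leb]_x f (x, y)).
Proof.
move=> fi; have mf := measurable_int _ fi.
apply/integrableP; split; first exact: (measurable_fubini_G fi).
have foo : \int[leb]_y \int[leb]_x `|f (x, y)| < +oo.
  by apply/(@integrable21ltyP _ _ _ _ R leb leb f mf).
apply: le_lt_trans foo; apply: ge0_le_integral => //.
- exact: (measurableT_comp (@abse_measurable _ _) (measurable_fubini_G fi)).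
- apply: (measurable_fun_fubini_tonelli_G (abse \o f)).
    exact: measurableT_comp.
  by move=> z; exact: abse_ge0.
- move=> y _; apply: le_abse_integral => //.
  exact: measurable_fun_pair1.
Qed.

Lemma rectangle_integral2 (f : RR -> \bar R) (A B : set (measurableTypeR R)) :
  measurable A -> measurable B -> leb2.-integrable setT f ->
  leb.-integrable setT (fun y => \int[leb]_(x in A) f (x, y)) /\
  \int[leb2]_(z in A `*` B) f z = \int[leb]_(y in B) \int[leb]_(x in A) f (x, y).
Proof.
move=> mA mB fi.
have restr (C : set RR) : measurable C -> leb2.-integrable setT (f \_ C).
  by move=> mC; apply/(integrable_mkcond _ mC); exact: integrableS fi.
split.
  have := integrable_section2 (restr _ (measurableX mA measurableT)).
  apply: eq_integrable => // y _; rewrite [RHS]integral_mkcond.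
  apply: eq_integral => x _; rewrite !patchE.
  by rewrite in_setX in_setT andbT.
rewrite integral_mkcond -(integral21_prod_meas1 (restr _ (measurableX mA mB))).
rewrite [RHS]integral_mkcond; apply: eq_integral => y _.
rewrite patchE; case: ifPn => yB.
  rewrite [RHS]integral_mkcond; apply: eq_integral => x _.
  by rewrite !patchE in_setX yB andbT.
apply: integral0_eq => x _; rewrite patchE in_setX.
by rewrite (negbTE yB) andbF.
Qed.

(** One side of the rectangle at a time is promoted from an interval to a
    measurable set, by Fubini and the result on the line; rectangles with
    measurable sides generate the product sigma-algebra. *)
Lemma null_on_rectangles (f : RR -> \bar R) (K : R) :
  leb2.-integrable setT f ->
  (forall z, ~~ ((- K <= z.1 <= K) && (- K <= z.2 <= K))%R -> f z = 0) ->
  (forall a b c d : R, \int[leb2]_(z in `[a, b] `*` `[c, d]) f z = 0) ->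
  {ae leb2, forall z, f z = 0}.
Proof.
move=> fi fK fI.
have step1 A c d : measurable A ->
    \int[leb2]_(z in A `*` (`[c, d]%classic : set (measurableTypeR R))) f z = 0.
  move=> mA; have mB : measurable (`[c, d]%classic : set (measurableTypeR R)) by [].
  have [gi ->] := rectangle_integral1 mA mB fi.
  apply: (null_on_intervals (K := K)) => //.
    move=> x xK; apply: integral0_eq => y _; apply: fK => /=.
    by rewrite (negbTE xK).
  move=> a b; have mI : measurable (`[a, b]%classic : set (measurableTypeR R)) by [].
  by have [_ <-] := rectangle_integral1 mI mB fi.
have step2 A B : measurable A -> measurable B ->
    \int[leb2]_(z in A `*` B) f z = 0.
  move=> mA mB; have [gi ->] := rectangle_integral2 mA mB fi.
  apply: (null_on_intervals (K := K)) => //.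
    move=> y yK; apply: integral0_eq => x _; apply: fK => /=.
    by rewrite (negbTE yK) andbF.
  move=> a b; have mI : measurable (`[a, b]%classic : set (measurableTypeR R)) by [].
  by have [_ <-] := rectangle_integral2 mA mI fi; exact: step1.
suff : ae_eq leb2 setT f (cst 0).
  by apply: ae_imply => z; apply.
apply: integral_ae_eq => // E _ mE.
rewrite integral0.
pose C : set (set RR) :=
  [set C | exists A, measurable A /\ exists B, measurable B /\ C = A `*` B].
have CI : setI_closed C.
  move=> /= _ _ [X1 [mX1 [X2 [mX2 ->]]]] [Y1 [mY1 [Y2 [mY2 ->]]]].
  rewrite -setXI; exists (X1 `&` Y1); split; first exact: measurableI.
  by exists (X2 `&` Y2); split => //; exact: measurableI.
apply: (@null_integral_dynkin _ _ R leb2 C f) => //.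
- rewrite measurable_prod_measurableType //; congr (<<s _ >>).
  rewrite predeqE; split => [[A mA [B mB <-]]|[A [mA [B [mB ->]]]]].
    by exists A; split => //; exists B.
  by exists A => //; exists B.
- by rewrite -setXTT; exact: step2.
- by move=> _ [A [mA [B [mB ->]]]]; exact: step2.
Qed.

End NullIntegrals.

(** * Injectivity of the map from symbols to forms *)

Section Vanishing.
Context {R : realType}.
Local Notation leb := (@lebesgue_measure R).
Local Notation leb2 := (leb \x leb)%E.
Local Notation RR := (measurableTypeR R * measurableTypeR R)%type.
Local Notation cmeasR f := (@cmeasurable R _ (measurableTypeR R) f).
Implicit Types (f g h : R -> R[i]) (m : RR -> R[i]) (a b c d : R).

Section AlmostEverywhereSlots.
Variables (t s : R).
Hypothesis ts : t + 2^-1 < s.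

Lemma trilinear_scale m (a b c : R[i]) f g h : admissible t m ->
  in_hs s f -> in_hs s g -> in_hs s h ->
  trilinear m (fun x => a * f x) (fun x => b * g x) (fun x => c * h x) =
  a * b * c * trilinear m f g h.
Proof.
move=> am hf hg hh; rewrite /trilinear -cintegralZl; last first.
  exact: (trilinear_integrable ts).
by apply: eq_cintegral => z; rewrite /freq_product; ring.
Qed.

(** The difference [f] of the two functions agrees almost everywhere with
    [0 * f], so its norm is zero and the bound of the form applies. *)
Lemma trilinear_ae1 m f1 f2 g h : admissible t m ->
  in_hs s f1 -> in_hs s f2 -> in_hs s g -> in_hs s h ->
  {ae leb, forall x, f1 x = f2 x} -> trilinear m f1 g h = trilinear m f2 g h.
Proof.
move=> am hf1 hf2 hg hh f12.
pose f x := -1 * f1 x + f2 x.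
have hf : in_hs s f := in_hsD (in_hsZ (-1) hf1) hf2.
have mf0 : cmeasR (fun x => 0 * f x).
  by apply: cmeasurableM; [exact: cmeasurable_cst|exact: in_hs_measurable hf].
have ff0 : {ae leb, forall x, f x = 0 * f x}.
  by apply: ae_imply f12 => x e; rewrite /f e; ring.
have [_ n0] := hs_norm_ae hf mf0 ff0.
have {}n0 : hs_norm s f = 0 by rewrite -n0 hs_normZ// cmod0 mul0r.
have [K K0 HK] := trilinear_bound ts am.
have := HK _ _ _ hf hg hh; rewrite n0 !mul0r mulr0 => T0.
have /eqP : cmod (trilinear m f g h) == 0 by rewrite eq_le T0 cmod_ge0.
move=> /eqP; rewrite cmod_eq0 (trilinear_linear1 ts)// mulN1r addrC subr_eq0.
by move=> /eqP.
Qed.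

Lemma trilinear_ae2 m f g1 g2 h : admissible t m ->
  in_hs s f -> in_hs s g1 -> in_hs s g2 -> in_hs s h ->
  {ae leb, forall x, g1 x = g2 x} -> trilinear m f g1 h = trilinear m f g2 h.
Proof.
move=> am hf hg1 hg2 hh g12.
rewrite (trilinear_swap12 ts am hf hg1 hh) (trilinear_swap12 ts am hf hg2 hh).
exact: trilinear_ae1 (admissible_swap12 am) hg1 hg2 hf hh g12.
Qed.

Lemma trilinear_ae3 m f g h1 h2 : admissible t m ->
  in_hs s f -> in_hs s g -> in_hs s h1 -> in_hs s h2 ->
  {ae leb, forall x, h1 x = h2 x} -> trilinear m f g h1 = trilinear m f g h2.
Proof.
move=> am hf hg hh1 hh2 h12.
rewrite (trilinear_swap23 ts am hf hg hh1) (trilinear_swap23 ts am hf hg hh2).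
exact: trilinear_ae2 (admissible_swap23 am) hf hh1 hh2 hg h12.
Qed.

Lemma trilinear_null m f g h : admissible t m ->
  {ae leb2, forall z, m z = 0} -> cmeasR f -> cmeasR g -> cmeasR h ->
  trilinear m f g h = 0.
Proof.
move=> [mm _] m0 mf mg mh; rewrite /trilinear -(@cintegral0 _ _ _ leb2).
apply: cintegral_ae.
- by apply: cmeasurableM => //; exact: cmeasurable_freq_product.
- exact: cmeasurable_cst.
- by apply: ae_imply m0 => z ->; rewrite mul0r.
Qed.

Section Converse.
Variable M : RR -> R[i].
Hypothesis aM : admissible t M.
Hypothesis M0 : forall u v w, sobolev s u -> sobolev s v -> sobolev s w ->
  trilinear M (fourier u) (fourier v) (fourier w) = 0.

Lemma trilinear_indicators a1 b1 a2 b2 a3 b3 :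
  trilinear M (indicator a1 b1) (indicator a2 b2) (indicator a3 b3) = 0.
Proof.
have [u1 [k1 k10 [[s1 hs1] e1]]] := sobolev_indicator_transform s a1 b1.
have [u2 [k2 k20 [[s2 hs2] e2]]] := sobolev_indicator_transform s a2 b2.
have [u3 [k3 k30 [[s3 hs3] e3]]] := sobolev_indicator_transform s a3 b3.
have hI := @in_hs_indicator R s.
have := M0 (conj s1 hs1) (conj s2 hs2) (conj s3 hs3).
rewrite (trilinear_ae1 aM hs1 (in_hsZ k1 (hI a1 b1)) hs2 hs3 e1).
rewrite (trilinear_ae2 aM (in_hsZ k1 (hI a1 b1)) hs2 (in_hsZ k2 (hI a2 b2)) hs3 e2).
rewrite (trilinear_ae3 aM (in_hsZ k1 (hI a1 b1)) (in_hsZ k2 (hI a2 b2)) hs3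
  (in_hsZ k3 (hI a3 b3)) e3).
rewrite trilinear_scale// => /eqP; rewrite !mulf_eq0.
by rewrite (negbTE k10) (negbTE k20) (negbTE k30) => /eqP.
Qed.

Lemma indicatorE a b x : indicator a b x = ((a <= x <= b)%R%:R)%:C.
Proof. by rewrite /indicator indicE mem_setE in_itv. Qed.

(** The symbol itself need not be integrable; it is cut off to a square, where it
    is. *)
Definition on_box (n : R) (z : RR) : R[i] :=
  M z * (indicator (- n) n z.1 * indicator (- n) n z.2).

(** On the box the difference of the coordinates lies in [[- 2 n, 2 n]], so that
    the middle indicator is 1 there. *)
Lemma on_box_rectangle n a b c d z :
  on_box n z * (indicator a b z.1 * indicator c d z.2) =
  M z * freq_product (indicator (Num.max (- b) (- n)) (Num.min (- a) n))
    (indicator (- (2 * n)) (2 * n))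
    (indicator (Num.max c (- n)) (Num.min d n)) z.
Proof.
rewrite /on_box /freq_product -mulrA; congr (_ * _).
rewrite !indicatorE -!(rmorphM (real_complex R))/= -!natrM !mulnb; congr ((_%:R)%:C); congr nat_of_bool.
by rewrite !ge_max !le_min; apply/idP/idP; lra.
Qed.

Lemma on_boxE n z : on_box n z = on_box n z *
  (indicator (- n) n z.1 * indicator (- n) n z.2).
Proof.
rewrite /on_box -!mulrA; congr (_ * _); rewrite !indicatorE -!(rmorphM (real_complex R))/= -!natrM.
by rewrite !mulnb; do 2 case: (_ <= _ <= _).
Qed.

Lemma on_box_integrable n : cintegrable leb2 (on_box n).
Proof.
have -> : on_box n = (fun z => M z * freq_product
    (indicator (Num.max (- n) (- n)) (Num.min (- - n) n))
    (indicator (- (2 * n)) (2 * n))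
    (indicator (Num.max (- n) (- n)) (Num.min n n)) z).
  by apply/funext => z; rewrite on_boxE on_box_rectangle.
by apply: (trilinear_integrable ts) => //; exact: in_hs_indicator.
Qed.

Lemma on_box_outside n z :
  ~~ ((- n <= z.1 <= n) && (- n <= z.2 <= n)) -> on_box n z = 0.
Proof.
rewrite /on_box !indicatorE -(rmorphM (real_complex R))/= -natrM mulnb => /negbTE ->.
by rewrite mulr0.
Qed.

Lemma on_box_null n : {ae leb2, forall z, on_box n z = 0}.
Proof.
have part (p : R[i] -> R) : (forall x y, p (x * (y%:C)) = p x * y) ->
    p 0 = 0 ->
    (forall F : RR -> R[i], cintegrable leb2 F -> leb2.-integrable setT (EFin \o (p \o F))) ->
    (forall F : RR -> R[i], cintegral leb2 F = 0 -> Rintegral leb2 setT (p \o F) = 0) ->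
    {ae leb2, forall z, (p (on_box n z))%:E = 0%E}.
  move=> pM p0 pI pz; have bi := pI _ (on_box_integrable n).
  apply: (null_on_rectangles (K := n)) => //.
    by move=> z /on_box_outside ->; rewrite p0.
  move=> a b c d; rewrite integral_mkcond.
  pose F z := M z * freq_product (indicator (Num.max (- b) (- n)) (Num.min (- a) n))
    (indicator (- (2 * n)) (2 * n))
    (indicator (Num.max c (- n)) (Num.min d n)) z.
  have Fi : cintegrable leb2 F.
    by apply: (trilinear_integrable ts) => //; exact: in_hs_indicator.
  have F0 : Rintegral leb2 setT (p \o F) = 0.
    apply: pz; exact: trilinear_indicators.
  have -> : (\int[leb2]_z ((fun z => (p (on_box n z))%:E) \_
      (`[a, b] `*` `[c, d])) z)%E = (\int[leb2]_z (p (F z))%:E)%E.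
    apply: eq_integral => z _; rewrite patchE in_setX !mem_setE !in_itv/=.
    rewrite /F -on_box_rectangle !indicatorE -(rmorphM (real_complex R))/= pM -natrM mulnb.
    by case: ifP; rewrite ?mulr1 ?mulr0.
  rewrite -[LHS]fineK; last exact: (integrable_fin_num measurableT (pI _ Fi)).
  by rewrite -[fine _]/(Rintegral leb2 setT (p \o F)) F0.
have hRe := part (@complex.Re R) _ _ _ _; have hIm := part (@complex.Im R) _ _ _ _.
apply: (ae_imply2 _ (hRe _ _ _ _) (hIm _ _ _ _)).
- by move=> z [] /= e1 [] /= e2; exact: complex_ext.
- by move=> x y; rewrite ReM/= mulr0 subr0.
- by [].
- by move=> F [].
- by move=> F [].
- by move=> x y; rewrite ImM/= mulr0 add0r.
- by [].
- by move=> F [].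
- by move=> F [].
Qed.

Lemma symbol_vanishes : {ae leb2, forall z, M z = 0}.
Proof.
have := @ae_foralln _ _ _ leb2 _ (fun n : nat => on_box_null n%:R).
apply: ae_imply => z H.
(* A square that contains [z]. *)
pose n := (Num.trunc (`|z.1| + `|z.2|)).+1.
have zn : `|z.1| + `|z.2| <= n%:R by apply: ltW; exact: truncnS_gt.
have := H n; rewrite /on_box !indicatorE -!ler_norml.
by rewrite (le_trans _ zn) ?lerDl// (le_trans _ zn) ?lerDr// !mulr1.
Qed.

End Converse.
End AlmostEverywhereSlots.
End Vanishing.

(** * Derivative of a cubic form *)

Section Frechet.
Context {R : realType}.
Local Notation leb := (@lebesgue_measure R).
Local Notation RR := (measurableTypeR R * measurableTypeR R)%type.
Implicit Types (u v w h : R -> R[i]) (m : RR -> R[i]).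

Lemma sobolev_in_hs s u : sobolev s u -> in_hs s (fourier u).
Proof. by case. Qed.

Lemma sobolevD s u h : sobolev s u -> sobolev s h ->
  sobolev s (fun x => u x + h x) /\
  {ae leb, forall xi, fourier (fun x => u x + h x) xi =
    1 * fourier u xi + fourier h xi}.
Proof.
move=> hu hh; have [H1 H2] := sobolev_linear 1 hu hh.
have e : (fun x => 1 * u x + h x) = (fun x => u x + h x).
  by apply/funext => x; rewrite mul1r.
by rewrite e in H1 H2; split => //; apply: ae_imply H2 => x ->.
Qed.

(** Multiplication by [a] is written as [(a - 1) * v + v], the shape to which the
    linearity clause of [is_frechet_derivative] applies. *)
Lemma sobolevZ s (a : R[i]) v : sobolev s v ->
  sobolev s (fun x => (a - 1) * v x + v x) /\
  sobolev_norm s (fun x => (a - 1) * v x + v x) = cmod a * sobolev_norm s v.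
Proof.
move=> hv; have [H1 H2] := sobolev_linear (a - 1) hv hv; split => //.
have [hh hn] := (sobolev_in_hs H1, hs_normZ a (sobolev_in_hs hv)).
rewrite -[RHS]hn; have ma := in_hs_measurable (in_hsZ a (sobolev_in_hs hv)).
have [|_ ->//] := hs_norm_ae hh ma.
by apply: ae_imply H2 => x <-; ring.
Qed.

Lemma sobolev_norm_ge0 s v : 0 <= sobolev_norm s v.
Proof. exact: hs_norm_ge0. Qed.

Lemma frechet_derivative_ext s Phi u L1 L2 :
  (forall v, sobolev s v -> L1 v = L2 v) ->
  is_frechet_derivative s Phi u L1 -> is_frechet_derivative s Phi u L2.
Proof.
move=> L12 [lin [C HC] dif]; split.
- move=> a v w hv hw.
  rewrite -(L12 _ (sobolev_linear a hv hw).1) -(L12 _ hv) -(L12 _ hw).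
  exact: lin.
- by exists C => v hv; rewrite -(L12 _ hv); exact: HC.
- move=> e e0; have [d d0 Hd] := dif e e0; exists d => [//|h hh hd].
  by rewrite -(L12 _ hh); exact: Hd.
Qed.

(** Test with the increment [tau * v]: the two remainders force
    [tau * |L1 v - L2 v| <= 2 * e * tau * |v|] for every positive [e]. *)
Lemma frechet_derivative_unique s Phi u L1 L2 v :
  is_frechet_derivative s Phi u L1 -> is_frechet_derivative s Phi u L2 ->
  sobolev s v -> L1 v = L2 v.
Proof.
move=> [lin1 _ dif1] [lin2 _ dif2] hv.
apply/eqP; rewrite -subr_eq0 -cmod_eq0; apply/negPn/negP => D0.
set D := cmod (L1 v - L2 v) in D0.
have {}D0 : 0 < D by rewrite lt0r D0 cmod_ge0.
set V := sobolev_norm s v; have V0 : 0 <= V by exact: sobolev_norm_ge0.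
(* The 1 keeps the denominators positive when [v] has norm zero. *)
pose e := D / (2 * (V + 1)).
have e0 : 0 < e by rewrite divr_gt0// mulr_gt0// ltr_wpDl.
have [d1 d10 H1] := dif1 e e0; have [d2 d20 H2] := dif2 e e0.
pose tau := Num.min d1 d2 / (V + 1).
have V1 : 0 < V + 1 by rewrite ltr_wpDl.
have tau0 : 0 < tau by rewrite divr_gt0// lt_min d10.
have tauV : tau * V < Num.min d1 d2.
  rewrite /tau mulrAC ltr_pdivrMr// ltr_pM2l ?lt_min ?d10//.
  by rewrite ltrDl.
have [hh hn] := sobolevZ tau%:C hv.
rewrite cmod_real gtr0_norm// -/V in hn.
have := H1 _ hh; have := H2 _ hh; rewrite hn => A2 A1.
move: tauV; rewrite lt_min => /andP[/A1 {}A1 /A2 {}A2].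
move: A1 A2; rewrite (lin1 _ _ _ hv hv) (lin2 _ _ _ hv hv); set P := Phi _; set Q := Phi u => A1 A2.
have : tau * D <= 2 * (e * (tau * V)).
  have -> : tau * D = cmod (P - Q - ((tau%:C - 1) * L2 v + L2 v)
      - (P - Q - ((tau%:C - 1) * L1 v + L1 v))).
    rewrite -[tau in LHS]gtr0_norm// -cmod_real -cmodM; congr cmod; ring.
  apply: le_trans (cmodD _ _) _; rewrite cmodN.
  by rewrite [leRHS](_ : _ = e * (tau * V) + e * (tau * V)) ?lerD//; ring.
have -> : 2 * (e * (tau * V)) = tau * (2 * (e * V)) by ring.
rewrite ler_pM2l// /e.
have -> : 2 * (D / (2 * (V + 1)) * V) = D * (V / (V + 1)).
  by field; rewrite gt_eqF.
by rewrite leNgt gtr_pMr// ltr_pdivrMr// mul1r ltrDl ltr01.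
Qed.

Lemma frechet_of_expansion s Phi u (L : (R -> R[i]) -> R[i]) (A C : R) : 0 <= A ->
  (forall (a : R[i]) v w, sobolev s v -> sobolev s w ->
    L (fun x => a * v x + w x) = a * L v + L w) ->
  (forall v, sobolev s v -> cmod (L v) <= C * sobolev_norm s v) ->
  (forall h, sobolev s h -> sobolev_norm s h <= 1 ->
    cmod (Phi (fun x => u x + h x) - Phi u - L h) <=
      A * (sobolev_norm s h * sobolev_norm s h)) ->
  is_frechet_derivative s Phi u L.
Proof.
move=> A0 lin bnd rem; split; [exact: lin|by exists C|move=> e e0].
have A1 : 0 < A + 1 by rewrite ltr_wpDl.
exists (Num.min 1 (e / (A + 1))); first by rewrite lt_min ltr01 divr_gt0.
move=> h hh; rewrite lt_min => /andP[/ltW H1].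
rewrite ltr_pdivlMr// => /ltW He; apply: le_trans (rem h hh H1) _.
rewrite mulrA ler_wpM2r ?sobolev_norm_ge0//; apply: le_trans He.
by rewrite mulrC mulrDr mulr1 lerDl sobolev_norm_ge0.
Qed.

Lemma scaled_linear (kappa a x y z : R[i]) : x = a * y + z ->
  kappa * x = a * (kappa * y) + kappa * z.
Proof. by move=> ->; ring. Qed.

Lemma scaled_bound (kappa x : R[i]) (K U H : R) : cmod x <= K * (H * U * U) ->
  cmod (kappa * x) <= cmod kappa * (K * (U * U)) * H.
Proof.
move=> h; rewrite cmodM -mulrA ler_wpM2l ?cmod_ge0//; apply: le_trans h _.
by rewrite le_eqVlt; apply/orP; left; apply/eqP; ring.
Qed.

(** The symbol of [v |-> T (v, u, u) + T (u, v, u) + T (u, u, v)], with the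
    varied function moved to the frequency [-xi]. *)
Definition deriv_symbol m (z : RR) : R[i] :=
  m z + m (swap12 z) + m (swap23 (swap12 z)).

Section Cubic.
Variables (t s : R).
Hypothesis ts : t + 2^-1 < s.
Variable m : RR -> R[i].
Hypothesis am : admissible t m.

Lemma admissible_deriv_symbol : admissible t (deriv_symbol m).
Proof.
apply: admissibleD; first apply: admissibleD => //.
  exact: admissible_swap12.
exact: (admissible_swap12 (admissible_swap23 am)).
Qed.

Lemma trilinear_deriv_symbol f g : in_hs s f -> in_hs s g ->
  trilinear (deriv_symbol m) g f f =
  trilinear m g f f + trilinear m f g f + trilinear m f f g.
Proof.
move=> hf hg; have am12 := admissible_swap12 am.
have am23 := admissible_swap23 am; have am2312 := admissible_swap12 am23.
rewrite (trilinear_symbolD ts (admissibleD am am12) am2312)//.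
rewrite (trilinear_symbolD ts am am12)//.
by rewrite -(trilinear_swap12 ts am)// (trilinear_swap23 ts am hf hf hg)
  (trilinear_swap12 ts am23).
Qed.

(** The factor 1 is the scalar in the linearity of the form in each slot. *)
Lemma trilinear_cube_expand f g : in_hs s f -> in_hs s g ->
  trilinear m (fun x => 1 * f x + g x) (fun x => 1 * f x + g x)
    (fun x => 1 * f x + g x) =
  trilinear m f f f + trilinear (deriv_symbol m) g f f +
  (trilinear m f g g + trilinear m g f g + trilinear m g g f + trilinear m g g g).
Proof.
move=> hf hg; have hS := in_hsD (in_hsZ 1 hf) hg.
rewrite trilinear_deriv_symbol//.
rewrite (trilinear_linear1 ts 1 am hf hg hS hS).
rewrite (trilinear_linear2 ts 1 am hf hf hg hS) (trilinear_linear2 ts 1 am hg hf hg hS).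
rewrite (trilinear_linear3 ts 1 am hf hf hf hg) (trilinear_linear3 ts 1 am hf hg hf hg).
rewrite (trilinear_linear3 ts 1 am hg hf hf hg) (trilinear_linear3 ts 1 am hg hg hf hg).
ring.
Qed.

(** The quadratic and cubic terms in the increment. *)
Lemma cubic_remainder (kappa : R[i]) f : in_hs s f -> exists2 A : R, 0 <= A &
  forall g, in_hs s g -> hs_norm s g <= 1 ->
    cmod (kappa * trilinear m (fun x => 1 * f x + g x) (fun x => 1 * f x + g x)
        (fun x => 1 * f x + g x)
      - kappa * trilinear m f f f - kappa * trilinear (deriv_symbol m) g f f)
    <= A * (hs_norm s g * hs_norm s g).
Proof.
move=> hf; have [K K0 HK] := trilinear_bound ts am.
pose U := hs_norm s f; have U0 : 0 <= U by exact: hs_norm_ge0.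
exists (cmod kappa * (K * (3 * U + 1))).
  by rewrite !mulr_ge0 ?cmod_ge0// addr_ge0// mulr_ge0.
move=> g hg; set H := hs_norm s g => H1.
have H0 : 0 <= H by exact: hs_norm_ge0.
rewrite (trilinear_cube_expand hf hg).
have b1 := HK _ _ _ hf hg hg; have b2 := HK _ _ _ hg hf hg.
have b3 := HK _ _ _ hg hg hf; have b4 := HK _ _ _ hg hg hg.
move: b1 b2 b3 b4; rewrite -/U -/H.
move: (trilinear m f f f) (trilinear (deriv_symbol m) g f f) => X Y.
move: (trilinear m f g g) (trilinear m g f g) (trilinear m g g f)
  (trilinear m g g g) => E1 E2 E3 E4 b1 b2 b3 b4.
have -> : kappa * (X + Y + (E1 + E2 + E3 + E4)) - kappa * X - kappa * Y =
  kappa * (E1 + E2 + E3 + E4) by ring.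
rewrite cmodM -mulrA ler_wpM2l ?cmod_ge0//.
apply: le_trans (le_trans (cmodD _ _) (lerD (le_trans (cmodD _ _)
  (lerD (le_trans (cmodD _ _) (lerD b1 b2)) b3)) b4)) _.
have -> : K * (U * H * H) + K * (H * U * H) + K * (H * H * U) + K * (H * H * H)
  = K * (3 * U + H) * (H * H) by ring.
by rewrite ler_wpM2r ?mulr_ge0// ler_wpM2l// lerD2l.
Qed.

(** The transform of a sum is the sum of the transforms only almost everywhere,
    which the form does not see. *)
Lemma trilinear_fourier_sum u h : sobolev s u -> sobolev s h ->
  let g := fourier (fun x => u x + h x) in
  let g' := fun x => 1 * fourier u x + fourier h x in
  trilinear m g g g = trilinear m g' g' g'.
Proof.
move=> hu hh g g'; have [hs ae] := sobolevD hu hh.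
have hg := sobolev_in_hs hs.
have hg' : in_hs s g' := in_hsD (in_hsZ 1 (sobolev_in_hs hu)) (sobolev_in_hs hh).
rewrite (trilinear_ae1 ts am hg hg' hg hg ae) (trilinear_ae2 ts am hg' hg hg' hg ae).
by rewrite (trilinear_ae3 ts am hg' hg' hg hg' ae).
Qed.

Lemma trilinear_fourier_linear (D : RR -> R[i]) (a : R[i]) v w f : admissible t D ->
  sobolev s v -> sobolev s w -> in_hs s f ->
  trilinear D (fourier (fun x => a * v x + w x)) f f =
  a * trilinear D (fourier v) f f + trilinear D (fourier w) f f.
Proof.
move=> aD hv hw hf; have [hl ae] := sobolev_linear a hv hw.
have hfv := sobolev_in_hs hv; have hfw := sobolev_in_hs hw.
exact: etrans (esym (trilinear_ae1 ts aD (in_hsD (in_hsZ a hfv) hfw)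
  (sobolev_in_hs hl) hf hf ae)) (trilinear_linear1 ts a aD hfv hfw hf hf).
Qed.

Lemma cubic_frechet_derivative (kappa : R[i]) u : sobolev s u ->
  is_frechet_derivative s
    (fun u => kappa * trilinear m (fourier u) (fourier u) (fourier u)) u
    (fun v => kappa * trilinear (deriv_symbol m) (fourier v) (fourier u) (fourier u)).
Proof.
move=> hu; have hfu := sobolev_in_hs hu.
have ad := admissible_deriv_symbol.
have [A A0 HA] := cubic_remainder kappa hfu.
have [K K0 HK] := trilinear_bound ts ad.
apply: (frechet_of_expansion (A := A)
  (C := cmod kappa * (K * (hs_norm s (fourier u) * hs_norm s (fourier u))))) => //.
- move=> a v w hv hw; apply: scaled_linear.
  exact: trilinear_fourier_linear ad hv hw hfu.
- move=> v hv; have := HK _ _ _ (sobolev_in_hs hv) hfu hfu.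
  exact: scaled_bound.
- move=> h hh h1.
  exact: (eq_ind_r (fun z => cmod (kappa * z - _ - _) <= _)
    (HA _ (sobolev_in_hs hh) h1) (trilinear_fourier_sum hu hh)).
Qed.

End Cubic.
End Frechet.

(** * The symbols of the functional and of its derivative *)

Section Symbols.
Context {R : realType}.
Local Notation leb := (@lebesgue_measure R).
Local Notation leb2 := (leb \x leb)%E.
Local Notation RR := (measurableTypeR R * measurableTypeR R)%type.
Implicit Types (n : R -> R -> R[i]) (p : R -> R -> R -> R[i]).
Implicit Types (f g : R -> R[i]) (t s a b c : R).

Definition cubic_symbol p (z : RR) : R[i] := p (- z.1) (z.1 - z.2) z.2.

(** The symbol of the pairing of [v] with [N (u, u)]: the output frequency [xi] is
    opposite to that of [v]. *)
Definition quadratic_symbol n (z : RR) : R[i] := n (z.1 - z.2) z.2.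

Lemma admissible_cubic_symbol t p :
  cmeasurable (fun z : measurableTypeR R * measurableTypeR R * measurableTypeR R =>
    p z.1.1 z.1.2 z.2) ->
  (exists C : R, forall xi eta sigma : R,
     cmod (p (xi - eta) (eta - sigma) sigma) <=
       C * (japanese (xi - eta) `^ t * japanese (eta - sigma) `^ t
            * japanese sigma `^ t)) ->
  admissible t (cubic_symbol p).
Proof.
move=> mp [C HC]; split.
  apply: (cmeasurable_comp mp (g := fun z : RR => (- z.1, z.1 - z.2, z.2))).
  apply: measurable_fun_pair; last exact: measurable_freq3.
  by apply: measurable_fun_pair; [exact: measurable_freq1|exact: measurable_freq2].
exists `|C| => // z; have := HC 0 z.1 z.2; rewrite sub0r japaneseN => h.
by apply: le_trans h _; rewrite ler_wpM2r ?ler_norm// !mulr_ge0 ?powR_ge0.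
Qed.

Lemma admissible_quadratic_symbol t n :
  cmeasurable (fun z : RR => n z.1 z.2) ->
  (exists C : R, forall xi eta : R,
     cmod (n (xi - eta) eta) <=
       C * (japanese xi `^ t * japanese (xi - eta) `^ t * japanese eta `^ t)) ->
  admissible t (quadratic_symbol n).
Proof.
move=> mn [C HC]; split.
  apply: (cmeasurable_comp mn (g := fun z : RR => (z.1 - z.2, z.2))).
  by apply: measurable_fun_pair; [exact: measurable_freq2|exact: measurable_freq3].
exists `|C| => // z; apply: le_trans (HC z.1 z.2) _.
by rewrite ler_wpM2r ?ler_norm// !mulr_ge0 ?powR_ge0.
Qed.

Definition fourier_const : R[i] := ((Num.sqrt (2 * pi))^-1)%:C.

Lemma sqrt2pi_gt0 : 0 < Num.sqrt (2 * pi) :> R.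
Proof. by rewrite sqrtr_gt0 mulr_gt0// pi_gt0. Qed.

Lemma fourier_const_neq0 : fourier_const != 0.
Proof.
by rewrite -cmod_eq0 cmod_real normr_eq0 invr_neq0// gt_eqF// sqrt2pi_gt0.
Qed.

Lemma integral_P_trilinear p u : integral_P p u =
  fourier_const * trilinear (cubic_symbol p) (fourier u) (fourier u) (fourier u).
Proof.
rewrite /integral_P /trilinear_hat /trilinear; move: (fourier u) => f.
rewrite mulrA -rmorphM/=; congr (_%:C * _).
  have q0 := gt_eqF sqrt2pi_gt0.
  rewrite -[X in _ / X]sqr_sqrtr ?mulr_ge0 ?pi_ge0//; field.
  by rewrite q0.
apply: eq_cintegral => -[x y]; rewrite /cubic_symbol /freq_product /= !sub0r.
by rewrite -!mulrA.
Qed.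

Section Pairing.
Variables (t s : R).
Hypothesis ts : t + 2^-1 < s.

(** The constant in front of the inner integral is carried by the symbol through
    Fubini. *)
Lemma bilinear_pairing n f g : admissible t (quadratic_symbol n) ->
  in_hs s f -> in_hs s g ->
  cintegral leb (fun xi => f (- xi) * (fourier_const *
    cintegral leb (fun eta => n (xi - eta) eta * g (xi - eta) * g eta))) =
  fourier_const * trilinear (quadratic_symbol n) f g g.
Proof.
move=> an hf hg; rewrite -(trilinear_symbolZ ts _ an hf hg hg).
rewrite (trilinear_fubini ts (admissibleZ _ an) hf hg hg).
apply: eq_cintegral => x; congr (_ * _).
transitivity (fourier_const * cintegral leb
    (fun y => quadratic_symbol n (x, y) * (g (x - y) * g y))).
  by congr (_ * _); apply: eq_cintegral => y; rewrite mulrA.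
rewrite -cintegralZl; last exact: (section_integrable ts x an hg hg).
by apply: eq_cintegral => y; rewrite mulrA.
Qed.

Lemma integral_vN_trilinear n v u : admissible t (quadratic_symbol n) ->
  sobolev s v -> sobolev s u ->
  integral_vN n v u = fourier_const *
    trilinear (quadratic_symbol n) (fourier v) (fourier u) (fourier u).
Proof.
move=> an hv hu.
exact: bilinear_pairing an (sobolev_in_hs hv) (sobolev_in_hs hu).
Qed.

Section Polarization.
Variable D : RR -> R[i].
Hypothesis aD : admissible t D.

Lemma trilinear_polarize v u w :
  (forall u, sobolev s u -> trilinear D (fourier v) (fourier u) (fourier u) = 0) ->
  sobolev s v -> sobolev s u -> sobolev s w ->
  trilinear (fun z => D z + D (swap23 z)) (fourier v) (fourier u) (fourier w) = 0.
Proof.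
move=> D0 hv hu hw; have [hs ae] := sobolevD hu hw.
have hS := sobolev_in_hs hs.
(* Vanishing at [u + w], at [u] and at [w]. *)
have := D0 _ hs; have := D0 _ hu; have := D0 _ hw.
move: {D0 hs} (fourier _) ae hS => F.
move: (fourier v) (fourier u) (fourier w) (sobolev_in_hs hv) (sobolev_in_hs hu)
  (sobolev_in_hs hw) => f g h hf hg hh ae hF Dh Dg.
have hS := in_hsD (in_hsZ 1 hg) hh.
rewrite (trilinear_ae2 ts aD hf hF hS hF ae) (trilinear_ae3 ts aD hf hS hF hS ae).
rewrite (trilinear_linear2 ts 1 aD hf hg hh hS).
rewrite (trilinear_linear3 ts 1 aD hf hg hg hh) (trilinear_linear3 ts 1 aD hf hh hg hh).
rewrite Dh Dg (trilinear_symbolD ts aD (admissible_swap23 aD) hf hg hh).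
rewrite -(trilinear_swap23 ts aD hf hh hg) => <-; ring.
Qed.

(** The restriction of the form to the diagonal [u = w] only sees the part of
    the symbol that is symmetric under the exchange of the last two slots. *)
Lemma diagonal_vanishes_iff :
  (forall u v, sobolev s u -> sobolev s v ->
    trilinear D (fourier v) (fourier u) (fourier u) = 0) <->
  {ae leb2, forall z, D z + D (swap23 z) = 0}.
Proof.
have aD' := admissible_swap23 aD; have aM := admissibleD aD aD'.
split=> [D0|M0 u v hu hv].
  apply: (symbol_vanishes ts aM) => v u w hv hu hw.
  exact: trilinear_polarize (fun u hu => D0 u v hu hv) hv hu hw.
have hf := sobolev_in_hs hv; have hg := sobolev_in_hs hu.
have := trilinear_null aM M0 (in_hs_measurable hf) (in_hs_measurable hg)
  (in_hs_measurable hg).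
move: {hu hv} (fourier u) (fourier v) hf hg => g f hf hg.
rewrite (trilinear_symbolD ts aD aD' hf hg hg) -(trilinear_swap23 ts aD hf hg hg).
by move=> /eqP; rewrite -mulr2n mulrn_eq0/= => /eqP.
Qed.

End Polarization.
End Pairing.

(** Grouped into [deriv_symbol] and its image under the exchange of [b] and
    [c]. *)
Definition perm_sum p a b c : R[i] :=
  p a b c + p b a c + p b c a + (p a c b + p c a b + p c b a).

(** The derivative formula says that the form with this symbol vanishes at
    [(v, u, u)] for all [u] and [v]. *)
Definition symbol_defect n p (z : RR) : R[i] :=
  quadratic_symbol n z + -1 * deriv_symbol (cubic_symbol p) z.

Lemma deriv_cubic_symbolE p (z : RR) : deriv_symbol (cubic_symbol p) z =
  p (- z.1) (z.1 - z.2) z.2 + p (z.1 - z.2) (- z.1) z.2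
  + p (z.1 - z.2) z.2 (- z.1).
Proof.
rewrite /deriv_symbol /cubic_symbol /swap23 /swap12 /=.
have -> : - (z.2 - z.1) = z.1 - z.2 by ring.
have -> : z.2 - z.1 - z.2 = - z.1 by ring.
by have -> : z.2 - z.1 - (- z.1) = z.2 by ring.
Qed.

Lemma symbol_defect_sym n p z :
  symbol_defect n p z + symbol_defect n p (swap23 z) =
  n (z.1 - z.2) z.2 + n z.2 (z.1 - z.2) - perm_sum p (- z.1) (z.1 - z.2) z.2.
Proof.
rewrite /symbol_defect !deriv_cubic_symbolE /quadratic_symbol /swap23 /perm_sum /=.
have -> : z.1 - (z.1 - z.2) = z.2 by ring.
by ring.
Qed.

(** Up to a factor 2, the two sides of the symmetrized identity differ by the sum
    computed in [symbol_defect_sym]. *)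
Lemma symbol_identity_symmetrized n p :
  symbol_identity (symmetrize2 n) (symmetrize3 p) <->
  {ae leb2, forall z, symbol_defect n p z + symbol_defect n p (swap23 z) = 0}.
Proof.
have key z : let: (xi, eta) := z in
    symmetrize2 n (xi - eta) eta - (symmetrize3 p eta (xi - eta) (- xi)
      + symmetrize3 p (- xi) eta (xi - eta) + symmetrize3 p (xi - eta) (- xi) eta)
    = 2^-1 * (symbol_defect n p z + symbol_defect n p (swap23 z)).
  case: z => xi eta; rewrite symbol_defect_sym /symmetrize2 /symmetrize3 /perm_sum /=.
  by field.
split; apply: ae_imply => -[xi eta] e; have := key (xi, eta).
  move=> /esym/eqP; rewrite e subrr mulf_eq0 invr_eq0 pnatr_eq0/=.
  by move=> /eqP.
by move=> /eqP; rewrite e mulr0 subr_eq0 => /eqP.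
Qed.

(** The identity at a point and at its image under [swap23] add up to the claim;
    the set where it fails stays null under this exchange. *)
Lemma symbol_identity_defect n p : symbol_identity n p ->
  {ae leb2, forall z, symbol_defect n p z + symbol_defect n p (swap23 z) = 0}.
Proof.
move=> np; have := preserves_ae (@preserves_swap23 R) np.
apply: (ae_imply2 _ np) => -[xi eta] e1; rewrite symbol_defect_sym /swap23 /= e1.
have -> : xi - (xi - eta) = eta by ring.
by move=> ->; rewrite /perm_sum; ring.
Qed.

Lemma symmetrize2_id n : symmetric2 n -> symmetrize2 n = n.
Proof.
move=> sn; apply/funext => a; apply/funext => b; rewrite /symmetrize2 (sn b a).
by field.
Qed.

Lemma symmetrize3_id p : symmetric3 p -> symmetrize3 p = p.
Proof.
move=> sp; apply/funext => a; apply/funext => b; apply/funext => c.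
have s12 x y z : p x y z = p y x z by have [] := sp x y z.
have s23 x y z : p x y z = p x z y by have [] := sp x y z.
rewrite /symmetrize3 (s12 b a c) (s23 b c a) (s12 b a c) (s12 c a b) (s23 a c b).
rewrite (s23 c b a) (s12 c a b) (s23 a c b).
by field.
Qed.

Section Formula.
Variables (t s : R) (n : R -> R -> R[i]) (p : R -> R -> R -> R[i]).
Hypothesis ts : t + 2^-1 < s.
Hypothesis ap : admissible t (cubic_symbol p).
Hypothesis an : admissible t (quadratic_symbol n).

Lemma integral_P_frechet u : sobolev s u ->
  is_frechet_derivative s (integral_P p) u (fun v => fourier_const *
    trilinear (deriv_symbol (cubic_symbol p)) (fourier v) (fourier u) (fourier u)).
Proof.
move=> hu; rewrite (funext (integral_P_trilinear p)).
exact: (cubic_frechet_derivative ts ap fourier_const hu).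
Qed.

Lemma derivative_formula_trilinear : derivative_formula s n p <->
  (forall u v, sobolev s u -> sobolev s v ->
    trilinear (quadratic_symbol n) (fourier v) (fourier u) (fourier u) =
    trilinear (deriv_symbol (cubic_symbol p)) (fourier v) (fourier u) (fourier u)).
Proof.
split=> [H u v hu hv|H u hu].
  apply: (mulfI fourier_const_neq0).
  exact: etrans (esym (integral_vN_trilinear ts an hv hu))
    (frechet_derivative_unique (H u hu) (integral_P_frechet hu) hv).
apply: (frechet_derivative_ext _ (integral_P_frechet hu)) => v hv.
exact: etrans (congr1 ( *%R fourier_const) (esym (H u v hu hv)))
  (esym (integral_vN_trilinear ts an hv hu)).
Qed.

Lemma derivative_formula_defect : derivative_formula s n p <->
  {ae leb2, forall z, symbol_defect n p z + symbol_defect n p (swap23 z) = 0}.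
Proof.
have ad := admissible_deriv_symbol ap; have adN := admissibleZ (-1) ad.
have defect f g : in_hs s f -> in_hs s g -> trilinear (symbol_defect n p) f g g =
    trilinear (quadratic_symbol n) f g g -
    trilinear (deriv_symbol (cubic_symbol p)) f g g.
  move=> hf hg; rewrite (trilinear_symbolD ts an adN hf hg hg).
  by rewrite (trilinear_symbolZ ts (-1) ad hf hg hg) mulN1r.
apply: (iff_trans derivative_formula_trilinear).
apply: (iff_trans _ (diagonal_vanishes_iff ts (admissibleD an adN))).
split=> H u v hu hv; have hf := sobolev_in_hs hv; have hg := sobolev_in_hs hu.
  apply: (etrans (defect _ _ hf hg)); apply/eqP; rewrite subr_eq0; apply/eqP.
  exact: H hu hv.
apply/eqP; rewrite -subr_eq0; apply/eqP.
exact: etrans (esym (defect _ _ hf hg)) (H u v hu hv).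
Qed.

(** Euler's identity for the cubic form. *)
Lemma integral_P_euler u : derivative_formula s n p -> sobolev s u ->
  integral_P p u = 3^-1 * integral_vN n u u.
Proof.
move=> /derivative_formula_trilinear H hu; have hf := sobolev_in_hs hu.
have e := etrans (integral_vN_trilinear ts an hu hu)
  (congr1 ( *%R fourier_const) (etrans (H u u hu hu)
    (trilinear_deriv_symbol ts ap hf hf))).
apply: (etrans (integral_P_trilinear p u)); apply/esym.
apply: (etrans (congr1 ( *%R 3^-1) e)).
move: (trilinear _ _ _ _) fourier_const => X k; by field.
Qed.

End Formula.
End Symbols.

Unset Implicit Arguments.

Theorem propositionA2 (R : realType) (t s : R)
    (n : R -> R -> R[i]) (p : R -> R -> R -> R[i])
    (n_meas : cmeasurable
       (fun z : measurableTypeR R * measurableTypeR R => n z.1 z.2))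
    (p_meas : cmeasurable
       (fun z : measurableTypeR R * measurableTypeR R * measurableTypeR R =>
          p z.1.1 z.1.2 z.2))
    (t_gt0 : 0 < t)
    (p_bound : exists C : R, forall xi eta sigma : R,
       cmod (p (xi - eta) (eta - sigma) sigma) <=
         C * (japanese (xi - eta) `^ t * japanese (eta - sigma) `^ t
              * japanese sigma `^ t))
    (n_bound : exists C : R, forall xi eta : R,
       cmod (n (xi - eta) eta) <=
         C * (japanese xi `^ t * japanese (xi - eta) `^ t * japanese eta `^ t))
    (s_gt : t + 2^-1 < s) :
  [/\ forall u, sobolev s u ->
        exists L, is_frechet_derivative s (integral_P p) u L,
      derivative_formula s n p <->
        symbol_identity (symmetrize2 n) (symmetrize3 p),
      symbol_identity n p -> derivative_formula s n p,
      symmetric2 n -> symmetric3 p ->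
        (derivative_formula s n p <-> symbol_identity n p)
    & derivative_formula s n p ->
        forall u, sobolev s u -> integral_P p u = 3^-1 * integral_vN n u u].
Proof.
have ap := admissible_cubic_symbol p_meas p_bound.
have an := admissible_quadratic_symbol n_meas n_bound.
have crit := derivative_formula_defect s_gt ap an.
have sym : derivative_formula s n p <->
    symbol_identity (symmetrize2 n) (symmetrize3 p).
  exact: iff_trans crit (iff_sym (symbol_identity_symmetrized n p)).
split.
- by move=> u hu; eexists; exact: (integral_P_frechet s_gt ap hu).
- exact: sym.
- by move=> np; apply/crit; exact: symbol_identity_defect.
- by move=> sn sp; rewrite -[X in _ <-> symbol_identity X _](symmetrize2_id sn)
    -[X in _ <-> symbol_identity _ X](symmetrize3_id sp).
- by move=> H u hu; exact: (integral_P_euler s_gt ap an H hu).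
Qed.
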